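(* Let $p<q<r$ be odd primes. Let $\Phi_{pqr}(x)=\sum_{i=0}^{\phi(pqr)}c_{i}x^{i}$ be the $pqr$-th cyclotomic polynomial, with integer coefficients $c_i$, and let $A(pqr)=\max\{|c_{i}| : 0\leqslant i\leqslant \phi(pqr)\}$. Then $A(pqr)\leqslant \frac{2}{3}p$.
   Context: For a positive integer $n$, the $n$-th cyclotomic polynomial $\Phi_n(x)=\prod_{1\leqslant a\leqslant n,\ (a,n)=1}(x-e^{2\pi i a/n})$ is the monic polynomial whose roots are exactly the primitive $n$-th roots of unity, each simple. It has integer coefficients and degree $\phi(n)$, where $\phi$ is the Euler totient function; in particular $\phi(pqr)=(p-1)(q-1)(r-1)$ for distinct primes $p,q,r$. The inequality $A(pqr)\leqslant\frac{2}{3}p$ is an inequality of real (rational) numbers. *)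

(* Defs.v *)
From mathcomp Require Import all_boot all_order all_algebra all_field.

Set Implicit Arguments.
Unset Strict Implicit.
Unset Printing Implicit Defensive.

Local Open Scope ring_scope.

(* A(n), the largest absolute value of a coefficient of 'Phi_n : {poly int}.
   In nat_scope the delimited bars denote [absz : int -> nat]; the index bound
   comes from [size_Cyclotomic : size 'Phi_n = (totient n).+1]. *)
Definition cyclotomic_height (n : nat) : nat :=
  (\max_(i < (totient n).+1) `|('Phi_n`_i)%R|)%N.

(* Main.v *)
(* Write [K = a q r + b p r + c p q - f p q r] with [0 <= a < p], [0 <= b < q] and
   [0 <= c < r]; for [K < p q r], [K] is a nonnegative combination of [q r],
   [p r], [p q] iff [f = 0].  Since [Phi_(pqr) (1 - X^(pqr))^2] is the product of
   [1 + X + ... + X^(p - 1)], [(1 - X^q) (1 - X^r)] and the sum of the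
   [X^(a q r + b p r + c p q)], a coefficient of [Phi_(pqr)] is, up to sign, the
   sum over [p] consecutive [K] of the alternating sum of [f = 0] over the four
   corners [K], [K + e1 q], [K + e2 r], [K + e1 q + e2 r].

   Let [rho, sig < p / 2] be inverses modulo [p] of [+- r] and [+- q], with
   [rho <= sig].  The [K] of the window realise each residue [a] once, and the
   alternating sum is at most 1 if [a < p - sig] and at most 0 otherwise.  If the
   total exceeded [2 p / 3], few terms could fall short of this bound, so nearly
   every [a < p - rho - sig] comes from a [K] in the core, where [b < B], [c < G]
   and [f = 0], and few [K] outside the core satisfy exactly one of [b < B] and
   [c < G].  Counting winding numbers of the three coordinates, which cancel,
   then shows that the core is an interval of consecutive integers, along which
   [a] moves by 1 or -1 and [b], [c] slowly the other way.  Points with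
   [a >= p - rho - sig] that must exist by counting are finally incompatible with
   continuing this line. *)
Require Import Defs.
From mathcomp Require Import all_boot all_order all_algebra all_field.
From mathcomp Require Import zify ring.
Set Implicit Arguments.
Unset Strict Implicit.
Unset Printing Implicit Defensive.
Import Order.TTheory GRing.Theory Num.Theory.
Local Open Scope ring_scope.

(** * A product formula for [Phi_(pqr)] *)

Lemma perm_divisors_primeM (p m : nat) :
  prime p -> (0 < m)%N -> ~~ (p %| m)%N ->
  perm_eq (divisors (p * m)) (divisors m ++ [seq (p * d)%N | d <- divisors m]).
Proof.
move=> p_pr m_gt0 pNm; have p_gt0 := prime_gt0 p_pr.
apply: uniq_perm; first exact: divisors_uniq.
  rewrite cat_uniq divisors_uniq map_inj_uniq ?divisors_uniq ?andbT /=; last first.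
    by move=> x y /eqP; rewrite eqn_pmul2l // => /eqP.
  apply/hasPn=> _ /mapP[d _ ->]; rewrite -dvdn_divisors //.
  by apply: contra pNm; apply: dvdn_trans; exact: dvdn_mulr.
move=> d; rewrite mem_cat -!dvdn_divisors ?muln_gt0 ?p_gt0 //.
apply/idP/orP=> [|[|/mapP[e]]].
- have [/dvdnP[e ->]|pNd] := boolP (p %| d)%N.
    rewrite mulnC dvdn_pmul2l // => em; right.
    by apply/mapP; exists e; rewrite // -dvdn_divisors.
  by rewrite Gauss_dvdr ?(coprime_sym d) ?prime_coprime // => ->; left.
- exact: dvdn_mull.
- by rewrite -dvdn_divisors // => em ->; rewrite dvdn_pmul2l.
Qed.

Lemma prod_Cyclotomic_primeM (p m : nat) :
  prime p -> (0 < m)%N -> ~~ (p %| m)%N ->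
  \prod_(d <- divisors (p * m)) 'Phi_d =
  (\prod_(d <- divisors m) 'Phi_d) * \prod_(d <- divisors m) 'Phi_(p * d).
Proof.
move=> p_pr m_gt0 pNm.
by rewrite (perm_big _ (perm_divisors_primeM p_pr m_gt0 pNm)) big_cat big_map.
Qed.

(** Moebius inversion with denominators cleared: once each [X^m - 1] is written as the product of
    [Phi_d] over the divisors [d] of [m], both sides have the same factors. *)
Lemma Cyclotomic_three_primes (p q r : nat) :
    prime p -> prime q -> prime r -> p != q -> p != r -> q != r ->
  'Phi_(p * q * r) * ('X^(p * q) - 1) * ('X^(p * r) - 1) * ('X^(q * r) - 1)
    * ('X - 1) =
  ('X^(p * q * r) - 1) * ('X^p - 1) * ('X^q - 1) * ('X^r - 1) :> {poly int}.
Proof.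
move=> p_pr q_pr r_pr pq pr qr.
have [p0 [q0 r0]] := (prime_gt0 p_pr, (prime_gt0 q_pr, prime_gt0 r_pr)).
have N1 x : prime x -> ~~ (x %| 1)%N.
  by move=> x_pr; rewrite dvdn1 neq_ltn prime_gt1 ?orbT.
have Nx x y : prime x -> prime y -> x != y -> ~~ (x %| y)%N.
  by move=> x_pr y_pr; rewrite dvdn_prime2.
have D1 : divisors 1 = [:: 1%N] by [].
have E1 : 'X - 1 = 'Phi_1 :> {poly int}.
  by have := @prod_Cyclotomic 1 isT; rewrite D1 big_seq1.
have Ex x : prime x -> 'X^x - 1 = 'Phi_1 * 'Phi_x :> {poly int}.
  move=> x_pr; rewrite -{1}[x]muln1 -prod_Cyclotomic ?muln1 ?prime_gt0 //.
  rewrite -{1}[x]muln1 prod_Cyclotomic_primeM ?N1 //.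
  by rewrite D1 !big_seq1 muln1.
have Exy x y : prime x -> prime y -> x != y ->
    'X^(x * y) - 1 = 'Phi_1 * 'Phi_y * ('Phi_x * 'Phi_(x * y)) :> {poly int}.
  move=> x_pr y_pr xy; rewrite -prod_Cyclotomic ?muln_gt0 ?prime_gt0 //.
  rewrite prod_Cyclotomic_primeM ?prime_gt0 ?Nx //.
  have D : perm_eq (divisors y) [:: 1%N; y].
    by have := perm_divisors_primeM y_pr (ltn0Sn 0) (N1 y y_pr); rewrite D1 /= !muln1.
  by rewrite !(perm_big _ D) !big_cons !big_nil /= !mulr1 muln1.
have Exyz : 'X^(p * q * r) - 1 =
    'Phi_1 * 'Phi_r * ('Phi_q * 'Phi_(q * r)) *
    ('Phi_p * 'Phi_(p * r) * ('Phi_(p * q) * 'Phi_(p * q * r))) :> {poly int}.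
  rewrite -prod_Cyclotomic ?muln_gt0 ?p0 ?q0 ?r0 // -mulnA.
  rewrite prod_Cyclotomic_primeM ?muln_gt0 ?q0 ?r0 ?Euclid_dvdM ?negb_or ?Nx //.
  have Dr : perm_eq (divisors r) [:: 1%N; r].
    by have := perm_divisors_primeM r_pr (ltn0Sn 0) (N1 r r_pr); rewrite D1 /= !muln1.
  have D : perm_eq (divisors (q * r)) [:: 1%N; r; q; (q * r)%N].
    apply: (perm_trans (perm_divisors_primeM q_pr r0 (Nx _ _ q_pr r_pr qr))).
    apply: (@perm_cat _ _ [:: 1%N; r] _ [:: q; (q * r)%N]) => //.
    by rewrite (perm_trans (perm_map _ Dr)) //= muln1.
  by rewrite !(perm_big _ D) !big_cons !big_nil /= !mulr1 !muln1 !mulrA.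
rewrite Exyz (Exy p q) ?(Exy p r) ?(Exy q r) ?(Ex p) ?(Ex q) ?(Ex r) ?E1 //; ring.
Qed.

(** * Coordinates of an integer *)

(* The solution in [0, m) of [n x = K] modulo [m], for coprime [m] and [n]. *)
Definition residue (m n : nat) (K : int) : int := ((K * (egcdz n m).1) %% m)%Z.

Lemma residue_bounds (m n : nat) K : (0 < m)%N -> 0 <= residue m n K < m%:Z.
Proof. by move=> m_gt0; rewrite modz_ge0 ?ltz_pmod //; lia. Qed.

Lemma dvdz_residue (m n : nat) K :
  coprime n m -> (m%:Z %| K - n%:Z * residue m n K)%Z.
Proof.
rewrite /residue; case: egcdzP => u v uv _ co /=.
have {}uv : u * n%:Z + v * m%:Z = 1.
  by rewrite uv /gcdz !absz_nat (eqP (_ : coprime n m)).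
have := divz_eq (K * u) m; set d := (_ %/ _)%Z; set t := (_ %% _)%Z => E.
apply/dvdzP; exists (K * v + n%:Z * d).
have -> : t = K * u - d * m%:Z by rewrite E; ring.
by rewrite -{1}[K]mulr1 -uv; ring.
Qed.

Section Coordinates.
Variables p q r : nat.

Definition coord_a := residue p (q * r).
Definition coord_b := residue q (p * r).
Definition coord_c := residue r (p * q).
(* The division is exact, see [coordE]. *)
Definition overflow (K : int) : int :=
  ((coord_a K * (q * r)%N + coord_b K * (p * r)%N + coord_c K * (p * q)%N - K)
     %/ (p * q * r)%N)%Z.

Hypotheses (p_gt0 : (0 < p)%N) (q_gt0 : (0 < q)%N) (r_gt0 : (0 < r)%N).
Hypotheses (co_pq : coprime p q) (co_pr : coprime p r) (co_qr : coprime q r).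

Lemma coord_a_bounds K : 0 <= coord_a K < p%:Z. Proof. exact: residue_bounds. Qed.
Lemma coord_b_bounds K : 0 <= coord_b K < q%:Z. Proof. exact: residue_bounds. Qed.
Lemma coord_c_bounds K : 0 <= coord_c K < r%:Z. Proof. exact: residue_bounds. Qed.

Let co_qp : coprime q p. Proof. by rewrite coprime_sym. Qed.
Let co_rp : coprime r p. Proof. by rewrite coprime_sym. Qed.
Let co_rq : coprime r q. Proof. by rewrite coprime_sym. Qed.

(** Modulo [p] only the term in [q r] survives, and [coord_a] solves that congruence; likewise
    modulo [q] and [r]. *)
Lemma coordE K :
  coord_a K * (q%:Z * r%:Z) + coord_b K * (p%:Z * r%:Z) + coord_c K * (p%:Z * q%:Z) =
  K + overflow K * (p%:Z * q%:Z * r%:Z).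
Proof.
suff /divzK E : ((p * q * r)%N%:Z %|
    coord_a K * (q * r)%N + coord_b K * (p * r)%N + coord_c K * (p * q)%N - K)%Z.
  by rewrite /overflow -!PoszM E !PoszM; ring.
have /dvdzP[x Ex] := @dvdz_residue p (q * r) K ltac:(by rewrite coprimeMl co_qp).
have /dvdzP[y Ey] := @dvdz_residue q (p * r) K ltac:(by rewrite coprimeMl co_pq).
have /dvdzP[z Ez] := @dvdz_residue r (p * q) K ltac:(by rewrite coprimeMl co_pr).
rewrite -/(coord_a K) -/(coord_b K) -/(coord_c K) !PoszM in Ex Ey Ez *.
rewrite Gauss_dvdz ?[coprimez _ _]coprimeMl /= ?co_pr //.
rewrite Gauss_dvdz //; apply/andP; split; first (apply/andP; split).
- apply/dvdzP; exists (- x + coord_b K * r%:Z + coord_c K * q%:Z); lia.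
- apply/dvdzP; exists (- y + coord_a K * r%:Z + coord_c K * p%:Z); lia.
- apply/dvdzP; exists (- z + coord_a K * q%:Z + coord_b K * p%:Z); lia.
Qed.

(** The coefficients are determined modulo [p], [q] and [r]; [i], [j], [k] count the periods in
    excess, and the overflow absorbs their sum. *)
Lemma coord_lift K a b c f :
    a * (q%:Z * r%:Z) + b * (p%:Z * r%:Z) + c * (p%:Z * q%:Z) =
      K + f * (p%:Z * q%:Z * r%:Z) ->
  exists i j k, [/\ a = coord_a K + i * p%:Z, b = coord_b K + j * q%:Z,
    c = coord_c K + k * r%:Z & f = overflow K + i + j + k].
Proof.
move=> E; have E0 := coordE K.
have H : (a - coord_a K) * (q%:Z * r%:Z) + (b - coord_b K) * (p%:Z * r%:Z) +
    (c - coord_c K) * (p%:Z * q%:Z) = (f - overflow K) * (p%:Z * q%:Z * r%:Z) by lia.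
have /dvdzP[i Ei] : (p%:Z %| a - coord_a K)%Z.
  rewrite -(@Gauss_dvdzl _ _ (q%:Z * r%:Z)) ?[coprimez _ _]coprimeMr ?co_pq //.
  apply/dvdzP; exists ((f - overflow K) * q%:Z * r%:Z - (b - coord_b K) * r%:Z -
    (c - coord_c K) * q%:Z); lia.
have /dvdzP[j Ej] : (q%:Z %| b - coord_b K)%Z.
  rewrite -(@Gauss_dvdzl _ _ (p%:Z * r%:Z)) ?[coprimez _ _]coprimeMr ?co_qp //.
  apply/dvdzP; exists ((f - overflow K) * p%:Z * r%:Z - (a - coord_a K) * r%:Z -
    (c - coord_c K) * p%:Z); lia.
have /dvdzP[k Ek] : (r%:Z %| c - coord_c K)%Z.
  rewrite -(@Gauss_dvdzl _ _ (p%:Z * q%:Z)) ?[coprimez _ _]coprimeMr ?co_rp //.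
  apply/dvdzP; exists ((f - overflow K) * p%:Z * q%:Z - (a - coord_a K) * q%:Z -
    (b - coord_b K) * p%:Z); lia.
exists i, j, k; split; [lia | lia | lia |].
have N0 : p%:Z * q%:Z * r%:Z != 0 by rewrite !mulf_neq0 //; lia.
suff : f - overflow K = i + j + k by lia.
by apply: (mulIf N0); rewrite -H Ei Ej Ek; ring.
Qed.
End Coordinates.

(** * Counting in windows, winding numbers and runs *)

Definition count_from (n : nat) (K0 : int) (P : int -> bool) : nat :=
  \sum_(i < n) P (K0 + i%:Z)%R.

Arguments count_from n%_N K0%_R P%_R.

Lemma in_window (n : nat) (K0 : int) (i : 'I_n) :
  K0 <= K0 + i%:Z < K0 + n%:Z.
Proof. by have := ltn_ord i; lia. Qed.

Lemma leq_count_fromD n K0 (P Q R : int -> bool) :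
    (forall K : int, K0 <= K < K0 + n%:Z -> P K -> Q K || R K) ->
  (count_from n K0 P <= count_from n K0 Q + count_from n K0 R)%N.
Proof.
move=> H; rewrite /count_from -big_split leq_sum // => i _.
by have := H _ (in_window K0 i); case: (P _) => // /(_ isT); case: (Q _); case: (R _).
Qed.

Lemma count_from_gt n K0 (P Q : int -> bool) :
    (count_from n K0 Q < count_from n K0 P)%N ->
  exists K, [/\ K0 <= K < K0 + n%:Z, P K & ~~ Q K].
Proof.
move=> lt; suff /existsP[i /andP[Pi Qi]] :
    [exists i : 'I_n, P (K0 + i%:Z) && ~~ Q (K0 + i%:Z)].
  by exists (K0 + i%:Z); split=> //; exact: in_window.
apply: contraLR lt => /existsPn H; rewrite -leqNgt leq_sum // => i _.
by have := H i; case: (P _) (Q _) => [] [].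
Qed.

Lemma sum_ord_interval (n x y : nat) :
  (\sum_(i < n) (x <= i < y) = minn n y - minn n x)%N.
Proof.
by elim: n => [|n IHn]; rewrite ?big_ord0 ?big_ord_recr /= ?IHn; lia.
Qed.

(** Pigeonhole: measured from its minimum on [P], [h] maps the points of [P] injectively into [m]
    values. *)
Lemma count_from_range n K0 (P : int -> bool) (h : int -> int) (m : nat) :
    (forall K K' : int, K0 <= K < K0 + n%:Z -> K0 <= K' < K0 + n%:Z ->
       P K -> P K' -> h K = h K' -> K = K') ->
    (forall K K' : int, K0 <= K < K0 + n%:Z -> K0 <= K' < K0 + n%:Z ->
       P K -> P K' -> h K' - h K < m%:Z) ->
  (count_from n K0 P <= m)%N.
Proof.
move=> h_inj h_lt; rewrite /count_from.
have -> : (\sum_(i < n) P (K0 + i%:Z)%R)%N = #|[pred i : 'I_n | P (K0 + i%:Z)]|.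
  by rewrite -sum1_card [RHS]big_mkcond; apply: eq_bigr => i _; rewrite inE; case: (P _).
have [i0 Pi0|noP] := pickP [pred i : 'I_n | P (K0 + i%:Z)]; last first.
  by rewrite eq_card0.
pose j := [arg min_(i < i0 | P (K0 + i%:Z)) h (K0 + i%:Z)]%O.
have [Pj minj] : P (K0 + j%:Z) /\
    forall i : 'I_n, P (K0 + i%:Z) -> h (K0 + j%:Z) <= h (K0 + i%:Z).
  by rewrite /j; case: arg_minP.
case: m h_lt => [|m] h_lt.
  by have := h_lt _ _ (in_window K0 j) (in_window K0 j) Pj Pj; lia.
pose g (i : 'I_n) : 'I_m.+1 := inord `|(h (K0 + i%:Z) - h (K0 + j%:Z))%R|%N.
rewrite -[m.+1]card_ord; apply: (@leq_card_in _ _ g) => i i'.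
rewrite !inE => Pi Pi' /(congr1 (@nat_of_ord _)).
have [[W W'] Wj] := (in_window K0 i, in_window K0 i', in_window K0 j).
rewrite /g !inordK.
- have := minj _ Pi; have := minj _ Pi' => m1 m2 E.
  have /h_inj : h (K0 + i%:Z) = h (K0 + i'%:Z) by lia.
  move=> /(_ (in_window K0 i) (in_window K0 i') Pi Pi') E'; apply: val_inj => /=; lia.
- by have := h_lt _ _ (in_window K0 j) (in_window K0 i') Pj Pi'; have := minj _ Pi'; lia.
- by have := h_lt _ _ (in_window K0 j) (in_window K0 i) Pj Pi; have := minj _ Pi; lia.
Qed.

Lemma count_fromZ n K0 P :
  (count_from n K0 P)%:Z = \sum_(i < n) (P (K0 + i%:Z)%R)%:Z.
Proof. exact: (big_morph Posz PoszD (erefl _)). Qed.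

(* Even on [k M, k M + B) and odd on the rest of [k M, (k + 1) M). *)
Definition level (M B x : int) : int := 2 * (x %/ M)%Z + (B <= (x %% M)%Z)%R%:Z.

(** The thresholds [k M] and [k M + B] are at least [B] apart, so a move of less than [B] crosses at
    most one. *)
Lemma level_step M B x y : 0 < B -> 2 * B <= M -> 0 <= y - x < B ->
  level M B x <= level M B y <= level M B x + 1.
Proof.
move=> B0 BM xy; rewrite /level.
have [Ex Ey] := (divz_eq x M, divz_eq y M).
have M0 : M != 0 by lia.
have [x0 y0] := (modz_ge0 x M0, modz_ge0 y M0).
have [x1 y1] : (x %% M)%Z < M /\ (y %% M)%Z < M by rewrite !ltz_pmod; lia.
move: (x %/ M)%Z (y %/ M)%Z (x %% M)%Z (y %% M)%Z Ex Ey x0 y0 x1 y1.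
move=> i j s t Ex Ey s0 t0 s1 t1; rewrite Ex Ey in xy => {Ex Ey}.
have [e|[e|]] : j = i \/ j = i + 1 \/ (j < i \/ i + 1 < j) by lia.
- by rewrite e in xy *; lia.
- by rewrite e in xy *; lia.
by case=> e; exfalso; nia.
Qed.

Lemma levelD M B k x : 0 <= x < M -> level M B (x + k * M) = 2 * k + (B <= x)%R%:Z.
Proof.
move=> xM; rewrite /level [x + _]addrC modzMDl divzMDl; last by lia.
rewrite modz_small // divz_small ?addr0 //; lia.
Qed.

(** * Lines winding around three circles *)

Section Gap.
Variables (p q r l B G x0 y0 z0 u v w Nx Ny Nz xn yn zn : int) (m n : nat).
Hypotheses (l0 : 0 < l) (lp : l < p).
Hypotheses (B0 : 0 < B) (Bq : 2 * B <= q) (G0 : 0 < G) (Gr : 2 * G <= r).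
Hypotheses (hx0 : 0 <= x0 < l) (hy0 : 0 <= y0 < B) (hz0 : 0 <= z0 < G).
Hypotheses (hxn : 0 <= xn < l) (hyn : 0 <= yn < B) (hzn : 0 <= zn < G).
Hypotheses (Ex : x0 + n%:Z * u = xn + Nx * p) (Ey : y0 + n%:Z * v = yn + Ny * q)
  (Ez : z0 + n%:Z * w = zn + Nz * r) (N0 : Nx + Ny + Nz = 0).
Hypotheses (mu : m%:Z * `|u| < l) (mv : m%:Z * `|v| < B) (mw : m%:Z * `|w| < G).

Let X (j : nat) := x0 + j%:Z * u.
Let Y (j : nat) := y0 + j%:Z * v.
Let Z (j : nat) := z0 + j%:Z * w.
(** On a line through core points, an index whose point is neither in the core nor [exceptional] is
    good. *)
Let good (j : nat) := (l <= (X j %% p)%Z) && (((Y j %% q)%Z < B) == ((Z j %% r)%Z < G)).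

(** Good indices thus follow each other at distance at most [m], over which [mu], [mv], [mw] keep
    the coordinates from moving as far as [l], [B], [G]. *)
Hypothesis dense : forall j : nat, (m < j <= n)%N ->
  exists2 j' : nat, (j - m <= j' < j)%N & good j'.

Let step (x M : int) (j j' : nat) : m%:Z * `|x| < M -> (j' <= j <= j' + m)%N ->
  `|j%:Z * x - j'%:Z * x| < M.
Proof.
move=> xM jj; rewrite -mulrBl normrM; apply: le_lt_trans xM.
by rewrite ler_wpM2r //; lia.
Qed.

Let sg (x : int) : int := if 0 <= x then 1 else -1.

Let sgP x : sg x = 1 /\ 0 <= x \/ sg x = -1 /\ x <= 0.
Proof. by rewrite /sg; case: leP => h; [left | right]; split=> //; lia. Qed.

Let mono (x : int) (j j' : nat) : (j' <= j)%N -> 0 <= sg x * (j%:Z * x - j'%:Z * x).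
Proof.
by move=> jj; rewrite -mulrBl mulrCA mulr_ge0 //; [lia | have := sgP x; lia].
Qed.

Let level_steps (M C t x : int) (j j' : nat) : 0 < C -> 2 * C <= M ->
    m%:Z * `|x| < C -> (j' <= j <= j' + m)%N ->
  0 <= sg x * (level M C (t + j%:Z * x) - level M C (t + j'%:Z * x)) <= 1.
Proof.
move=> C0 CM xC jj; have := step xC jj; have := @mono x j j' ltac:(lia).
have [[-> _]|[-> _]] := sgP x => s1 s2.
  by have := @level_step M C (t + j'%:Z * x) (t + j%:Z * x) C0 CM ltac:(lia); lia.
by have := @level_step M C (t + j%:Z * x) (t + j'%:Z * x) C0 CM ltac:(lia); lia.
Qed.

(* The sign-normalised levels in the last two coordinates never separate at a
   good index: over at most [m] steps each grows by 0 or 1, and their parities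
   agree at good indices. *)
Let invariant (j : nat) : Prop :=
  [/\ sg v * level q B (Y j) = sg w * level r G (Z j)
    & (0 < j)%N -> if 0 <= u then l <= X j < p else l - p <= X j < 0].

Let levels_agree (j : nat) : ((Y j %% q)%Z < B) = ((Z j %% r)%Z < G) ->
  exists h k k', level q B (Y j) = 2 * k + h /\ level r G (Z j) = 2 * k' + h.
Proof.
move=> E; exists (B <= (Y j %% q)%Z)%R%:Z, (Y j %/ q)%Z, (Z j %/ r)%Z.
by rewrite /level !leNgt E.
Qed.

Let start : [/\ X 0 = x0, Y 0 = y0 & Z 0 = z0].
Proof. by rewrite /X /Y /Z !mul0r !addr0. Qed.

Let finish : [/\ X n = xn + Nx * p, Y n = yn + Ny * q & Z n = zn + Nz * r].
Proof. by []. Qed.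

Let levelS (M C k x : int) : 0 <= x < C -> 2 * C <= M -> level M C (x + k * M) = 2 * k.
Proof. by move=> h1 h2; rewrite levelD; lia. Qed.

Let previous (j : nat) : (0 < j <= n)%N ->
  exists2 j' : nat, (j' < j <= j' + m)%N & (j' == 0%N) || good j'.
Proof.
move=> jn; have [jm|jm] := leqP j m; first by exists 0%N => //; lia.
have /dense[j' h gj'] : (m < j <= n)%N by lia.
by exists j'; rewrite ?gj' ?orbT //; lia.
Qed.

Let sync (j j' : nat) : (j' < j <= j' + m)%N ->
    ((Y j %% q)%Z < B) = ((Z j %% r)%Z < G) ->
    ((Y j' %% q)%Z < B) = ((Z j' %% r)%Z < G) ->
    sg v * level q B (Y j') = sg w * level r G (Z j') ->
  sg v * level q B (Y j) = sg w * level r G (Z j).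
Proof.
move=> jj /levels_agree[h [k [k' [Ey1 Ez1]]]] /levels_agree[h' [t [t' [Ey2 Ez2]]]].
have := @level_steps q B y0 v j j' B0 Bq mv ltac:(lia).
have := @level_steps r G z0 w j j' G0 Gr mw ltac:(lia).
rewrite -/(Y j) -/(Y j') -/(Z j) -/(Z j') Ey1 Ey2 Ez1 Ez2.
by have [[-> _]|[-> _]] := sgP v; have [[-> _]|[-> _]] := sgP w; lia.
Qed.

(** Moving monotonically by less than [l], the first coordinate cannot jump over the block of length
    [l] that follows [[l, p)], or precedes [[l - p, 0)] if [u < 0]. *)
Let advance (j j' : nat) : (j' < j)%N -> (j <= j' + m)%N ->
    ((0 < j')%N -> if 0 <= u then l <= X j' < p else l - p <= X j' < 0) ->
  if 0 <= u then 0 <= X j < p + l else - p < X j < l.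
Proof.
move=> jj1 jj2; have := step mu (introT andP (conj (ltnW jj1) jj2)).
have := mono u (ltnW jj1); have [X0 _ _] := start.
have E : j%:Z * u - j'%:Z * u = X j - X j' by rewrite /X; ring.
rewrite E; have [j'0|_ + + /(_ isT)] := posnP j'.
  rewrite j'0 X0 /sg => + + _; clear -hx0 lp.
  by case: ifP => _; lia.
by rewrite /sg; clear -lp l0; case: ifP => _; lia.
Qed.

Let agree0 : ((Y 0 %% q)%Z < B) = ((Z 0 %% r)%Z < G).
Proof. by have [_ -> ->] := start; rewrite !modz_small; lia. Qed.

Let invariantP (j : nat) : (j <= n)%N -> (j == 0%N) || good j -> invariant j.
Proof.
elim/ltn_ind: j => j IH jn gj.
have [j0|j0] := posnP j.
  rewrite j0; split=> //; have [_ -> ->] := start.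
  rewrite -[y0]addr0 -[z0]addr0 -{1}[0](mul0r q) -{2}[0](mul0r r) !levelS //; lia.
have {gj} /andP[gx /eqP gyz] : good j by move: gj; case: eqP => [|//]; lia.
have /previous[j' jj gj'] : (0 < j <= n)%N by lia.
have jj1 : (j' < j)%N by case/andP: jj.
have jn1 : (j' <= n)%N := leq_trans (ltnW jj1) jn.
have [I1 I2] := IH j' jj1 jn1 gj'.
have agr : ((Y j' %% q)%Z < B) = ((Z j' %% r)%Z < G).
  by case/orP: gj' => [/eqP->|/andP[_ /eqP]].
split=> [|_]; first exact: sync jj gyz agr I1.
have := advance jj1 (andP jj).2 I2.
have := divz_eq (X j) p; have : (X j %% p)%Z < p by rewrite ltz_pmod //; clear -l0 lp; lia.
move: gx; move: (X j) (X j %% p)%Z (X j %/ p)%Z => x t d lt tp ->.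
clear -lt tp lp l0; case: ifP => _ h;
  by (have [?|[?|[?|?]]] : d = 0 \/ d = -1 \/ 1 <= d \/ d <= -2 by lia); subst; nia.
Qed.

Hypothesis n0 : (0 < n)%N.

(* The last two levels force [Ny = +- Nz], the first coordinate forces
   [|Nx| <= 1], and [Nx + Ny + Nz = 0]: so [Nx] is even, hence 0.  Then [n <= m],
   since [X] is monotone and lies outside [0, l) at every good index. *)
Lemma no_winding : [/\ Nx = 0, Ny = 0 & Nz = 0].
Proof.
have /previous[j jj gj] : (0 < n <= n)%N by rewrite n0 leqnn.
have jn : (j < n)%N by case/andP: jj.
have [I1 I2] := invariantP (ltnW jn) gj.
have agr : ((Y j %% q)%Z < B) = ((Z j %% r)%Z < G).
  by case/orP: gj => [/eqP->|/andP[_ /eqP]].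
have [XnE YnE ZnE] := finish.
have agrn : ((Y n %% q)%Z < B) = ((Z n %% r)%Z < G).
  have hyq : 0 <= yn < q by clear -hyn Bq; lia.
  have hzr : 0 <= zn < r by clear -hzn Gr; lia.
  rewrite YnE ZnE (addrC yn) (addrC zn) !modzMDl (modz_small hyq) (modz_small hzr).
  by case/andP: hyn => _ ->; case/andP: hzn => _ ->.
have := sync jj agrn agr I1; rewrite YnE ZnE !levelS // => E.
have Nx1 : `|Nx| <= 1.
  have := advance jn (andP jj).2 I2; rewrite XnE.
  clear -hxn lp l0; case: ifP => _ h;
  by (have [?|[?|?]] : `|Nx| <= 1 \/ 2 <= Nx \/ Nx <= -2 by lia); nia.
have [|opp] : sg v = sg w \/ sg v = - sg w.
- by have [[-> _]|[-> _]] := sgP v; have [[-> _]|[-> _]] := sgP w; lia.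
- by move=> e; have [[e' _]|[e' _]] := sgP w; move: E; rewrite e e'; clear -N0 Nx1 => ?; split; lia.
have Nyz : Ny = - Nz.
  by have [[e _]|[e _]] := sgP w; move: E; rewrite opp e; clear -N0 Nx1; lia.
have Nx0 : Nx = 0 by clear -N0 Nyz; lia.
have nm : (n <= m)%N.
  rewrite leqNgt; apply/negP => mn.
  have /dense[j' jj' gj'] : (m < n <= n)%N by rewrite mn leqnn.
  have [j'0 j'n] : (0 < j')%N /\ (j' < n)%N by clear -jj' mn; lia.
  have [_ /(_ j'0)] := invariantP (ltnW j'n) (introT orP (or_intror gj')).
  have := @mono u n j' (ltnW j'n); have := @mono u j' 0 (ltnW j'0).
  rewrite /X mul0r; move: XnE; rewrite /X Nx0 /sg mul0r addr0; clear -hxn hx0.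
  by case: ifP => _; lia.
(* Within [n <= m] steps the level moves by at most 1, while it goes from 0 to [2 Ny]. *)
have := @level_steps q B y0 v n 0%N B0 Bq mv; rewrite add0n nm -/(Y n) -/(Y 0).
have L0 : level q B y0 = 0 by have := levelS 0 hy0 Bq; rewrite mul0r addr0 mulr0.
have [_ -> _] := start; rewrite YnE levelS // L0 subr0 => /(_ isT) h.
by have [[e _]|[e _]] := sgP v; rewrite e in h; clear -Nx0 Nyz h; split=> //; lia.
Qed.

End Gap.

(* Each [i] with [P i] covers the three indices [i, i + 1, i + 2]; an index is
   covered twice only if it carries two elements at distance 2. *)
Lemma sum_sparse (n : nat) (P X : nat -> bool) :
    (forall i, i < n.+1 -> P i -> ~~ P i.+1)%N ->
    (forall i, i < n -> P i -> P i.+2 -> X i.+1)%N ->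
  (3 * (\sum_(i < n.+2) P i) <=
     n.+2 + \sum_(i < n.+1) X i + 2 * P n.+1 + P n)%N.
Proof.
elim: n => [|n IHn] Padj PX.
  rewrite !big_ord_recr !big_ord0 /=; have := Padj 0%N isT.
  by case: (P 0%N); case: (P 1%N) => /=; lia.
have := IHn (fun i h => Padj i (ltnW h)) (fun i h => PX i (ltnW h)).
have SS (Q : nat -> bool) k : (\sum_(i < k.+1) Q i = \sum_(i < k) Q i + Q k)%N.
  exact: big_ord_recr.
rewrite (SS P n.+2) (SS X n.+1).
have := Padj n ltac:(lia); have := Padj n.+1 ltac:(lia); have := PX n ltac:(lia).
by case: (P n.+2); case: (P n.+1); case: (P n); case: (X n.+1) => /=; lia.
Qed.

(** Such points are at least 3 apart, so at most [j] lie before [3 j] and at most [m - j] after it;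
    having [m + 1] points forces one at [3 j] itself. *)
Lemma sum_gap3 (m : nat) (P : nat -> bool) :
    (forall i, i < 3 * m -> P i -> ~~ P i.+1)%N ->
    (forall i, i.+1 < 3 * m -> P i -> ~~ P i.+2)%N ->
    (m < \sum_(i < (3 * m).+1) P i)%N ->
  forall j, (j <= m)%N -> P (3 * j)%N.
Proof.
move=> P1 P2; set s := fun n => (\sum_(i < n) P i)%N => sm j jm.
have s3 n : (n.+2 <= 3 * m)%N -> (s n.+3 <= s n + 1)%N.
  move=> nm; rewrite /s !big_ord_recr /=.
  have := P1 n ltac:(lia); have := P1 n.+1 ltac:(lia); have := P2 n ltac:(lia).
  by case: (P n); case: (P n.+1); case: (P n.+2) => /=; lia.
have lo k : (k <= m)%N -> (s (3 * k) <= k)%N.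
  elim: k => [|k IHk] km; first by rewrite /s big_ord0.
  have := s3 (3 * k)%N ltac:(lia); have := IHk ltac:(lia).
  by rewrite (_ : (3 * k.+1) = (3 * k).+3)%N; lia.
have hi k : (k <= m)%N -> (m - k < s (3 * (m - k)).+1)%N.
  elim: k => [|k IHk] km; first by rewrite subn0.
  have := s3 (3 * (m - k.+1)).+1 ltac:(lia); have := IHk ltac:(lia).
  by rewrite (_ : (3 * (m - k)) = (3 * (m - k.+1)).+3)%N; lia.
have := lo j jm; have := hi (m - j)%N (leq_subr _ _); rewrite subKn //.
by rewrite /s big_ord_recr /=; case: (P _); lia.
Qed.

(* [P] splits into runs of length at most [l + 1] separated by gaps that each
   contain at least [l >= 1] points of [X]; two runs would make [X] too large. *)
Section Runs.
Local Open Scope nat_scope.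
Variables (p l : nat) (P X : nat -> bool).

Let cnt (Q : nat -> bool) (n : nat) : nat := \sum_(i < n) Q i.

Lemma cntS (Q : nat -> bool) n : cnt Q n.+1 = cnt Q n + Q n.
Proof. exact: big_ord_recr. Qed.

Lemma cnt_mono (Q : nat -> bool) m n : m <= n -> cnt Q m <= cnt Q n.
Proof.
elim: n => [|n IHn] mn; first by rewrite (_ : m = 0) //; lia.
have [->//|ne] := eqVneq m n.+1; rewrite cntS.
by have := IHn ltac:(lia); lia.
Qed.

Lemma cnt_none (Q : nat -> bool) m n : m <= n -> (forall j, m <= j < n -> ~~ Q j) ->
  cnt Q n = cnt Q m.
Proof.
elim: n => [|n IHn] mn H; first by rewrite (_ : m = 0) ?subnn ?addn0 //; lia.
have [->//|ne] := eqVneq m n.+1.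
rewrite cntS (negPf (H n ltac:(lia))) addn0 IHn //; first lia.
by move=> j jn; apply: H; lia.
Qed.

Lemma cnt_all (Q : nat -> bool) m n : m <= n -> (forall j, m <= j < n -> Q j) ->
  cnt Q n = cnt Q m + (n - m).
Proof.
elim: n => [|n IHn] mn H; first by rewrite (_ : m = 0) ?subnn ?addn0 //; lia.
have [->|ne] := eqVneq m n.+1; first by rewrite subnn addn0.
rewrite cntS (H n ltac:(lia)) IHn; [lia | lia |].
by move=> j jn; apply: H; lia.
Qed.

Lemma last_before n : (forall j, j < n -> ~~ P j) \/
  exists e, [/\ e < n, P e & forall j, e < j < n -> ~~ P j].
Proof.
elim: n => [|n IHn]; first by left.
have [Pn|nPn] := boolP (P n); first by right; exists n; split=> // j; lia.
case: IHn => [H|[e [en Pe H]]]; [left=> j jn | right; exists e; split=> //; [lia|]].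
  by have [->//|jn'] := eqVneq j n; apply: H; lia.
by move=> j jn; have [->//|jn'] := eqVneq j n; apply: H; lia.
Qed.

Hypothesis l_gt0 : 0 < l.
Hypothesis run_le : forall i m, i + m < p -> (forall j, j <= m -> P (i + j)) -> m <= l.
Hypothesis gap_ge : forall e s, e.+1 < s < p -> P e -> P s ->
  (forall j, e < j < s -> ~~ P j) -> cnt X e.+1 + l <= cnt X s.

(** Here [s] starts the run containing [i], and [k] counts the earlier runs: each has at most
    [l + 1] points and is followed by a gap holding at least [l] points of [X]. *)
Let run_state i : i < p -> P i -> exists s k, [/\ s <= i, forall j, s <= j <= i -> P j,
  cnt P s <= k * l.+1, k * l <= cnt X s & k = 0 -> forall j, j < s -> ~~ P j].
Proof.
elim/ltn_ind: i => i IH ip Pi.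
case: (last_before i) => [none|[e [ei Pe none]]].
  exists i, 0; split=> //; first by move=> j ji; rewrite (_ : j = i) //; lia.
  by rewrite (@cnt_none P 0 i) //; rewrite /cnt big_ord0.
have [s [k [se run c1 c2 k0]]] := IH e ei (ltn_trans ei ip) Pe.
have [i1|i1] := eqVneq i e.+1.
  exists s, k; split=> //; first lia.
  by move=> j ji; have [->//|ne] := eqVneq j i; apply: run; lia.
have gap := gap_ge (e := e) (s := i) ltac:(lia) Pe Pi none.
exists i, k.+1; split=> //.
- by move=> j ji; rewrite (_ : j = i) //; lia.
- rewrite (@cnt_none P e.+1 i) //.
  rewrite (@cnt_all P s e.+1) //; [| lia].
  have := @run_le s (e - s) ltac:(lia) => /(_ _); rewrite mulSn.
  by move=> /(_ (fun j h => run (s + j) ltac:(lia))); lia.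
- by have := @cnt_mono X s e.+1 ltac:(lia); rewrite mulSn; lia.
Qed.

Lemma single_run : 3 * cnt X p + 2 <= cnt P p ->
  exists s m, [/\ s + m < p, cnt P p = m.+1 & forall j, j <= m -> P (s + j)].
Proof.
move=> many; case: (last_before p) => [none|[i [ip Pi none]]].
  by move: many; rewrite (@cnt_none P 0 p) // /cnt big_ord0; lia.
have [s [k [si run c1 c2 k0]]] := run_state ip Pi.
have Ep : cnt P p = cnt P s + (i.+1 - s).
  rewrite (@cnt_none P i.+1 p) // (@cnt_all P s i.+1) //; lia.
have il : i - s <= l.
  by apply: (@run_le s); [lia | move=> j js; apply: run; lia].
have sX := @cnt_mono X s p ltac:(lia).
(* For [k >= 1] one would get [(k + 1) (l + 1) >= 3 k l + 2], which is false when [l >= 1]. *)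
have kz : k = 0 by clear -many Ep il sX c1 c2 l_gt0; nia.
have s0 : cnt P s = 0 by move: c1; rewrite kz; lia.
exists s, (i - s); split; [lia | lia | move=> j js; apply: run; lia].
Qed.
End Runs.

Lemma carryD (m x y t i : int) : 0 <= x < m -> 0 <= y < m -> 0 <= t <= m ->
  x + t = y + i * m -> i = (m <= x + t)%R%:Z.
Proof.
move=> Hx Hy Ht E; have : -1 < i < 2 by nia.
have [le|gt] := boolP (m <= x + t) => /= Hi; last by nia.
have : i != 0 by apply/eqP => i0; lia.
lia.
Qed.

Lemma carryB (m x y t i : int) : 0 <= x < m -> 0 <= y < m -> 0 <= t <= m ->
  x - t = y + i * m -> i = - (x < t)%R%:Z.
Proof.
move=> Hx Hy Ht E; have : -2 < i < 1 by nia.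
have [le|gt] := boolP (x < t) => /= Hi; last by nia.
have : i != 0 by apply/eqP => i0; lia.
lia.
Qed.

Lemma carry0 (m x y i : int) : 0 <= x < m -> 0 <= y < m ->
  x = y + i * m -> i = 0.
Proof.
move=> Hx Hy E; have [i1 i2] : -1 < i /\ i < 1 by split; nia.
lia.
Qed.

(** * Alternating sums over squares *)

(* Multiplying [rhoE] by [q] and [sigE] by [r] gives [e1 q = rho q r - G p q] and
   [e2 r = sig q r - B p r]: adding [e1 q] to [K] shifts [a] by [rho] and [c] by [- G], and
   adding [e2 r] shifts [a] by [sig] and [b] by [- B]. *)
Record steps (p q r : nat) (rho sig G B e1 e2 : int) : Prop := Steps {
  p_gt1 : (1 < p)%N; p_odd : odd p; lt_pq : (p < q)%N; lt_pr : (p < r)%N;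
  co_pq : coprime p q; co_pr : coprime p r; co_qr : coprime q r;
  e1P : e1 = 1 \/ e1 = -1; e2P : e2 = 1 \/ e2 = -1;
  rhoE : rho * r%:Z = G * p%:Z + e1; sigE : sig * q%:Z = B * p%:Z + e2;
  rho_gt0 : 0 < rho; le_rs : rho <= sig; sig_lt : 2 * sig < p%:Z }.

Section Steps.
Variables (p q r : nat) (rho sig G B e1 e2 : int).
Hypothesis S : steps p q r rho sig G B e1 e2.

Local Notation a := (coord_a p q r).
Local Notation b := (coord_b p q r).
Local Notation c := (coord_c p q r).
Local Notation f := (overflow p q r).

Let p_gt0 : (0 < p)%N. Proof. by have := p_gt1 S; lia. Qed.
Let q_gt0 : (0 < q)%N. Proof. by have := lt_pq S; lia. Qed.
Let r_gt0 : (0 < r)%N. Proof. by have := lt_pr S; lia. Qed.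

Lemma a_bounds K : 0 <= a K < p%:Z. Proof. exact: coord_a_bounds. Qed.
Lemma b_bounds K : 0 <= b K < q%:Z. Proof. exact: coord_b_bounds. Qed.
Lemma c_bounds K : 0 <= c K < r%:Z. Proof. exact: coord_c_bounds. Qed.

Lemma coordsE K :
  a K * (q%:Z * r%:Z) + b K * (p%:Z * r%:Z) + c K * (p%:Z * q%:Z) =
  K + f K * (p%:Z * q%:Z * r%:Z).
Proof. by apply: coordE; rewrite ?(co_pq S) ?(co_pr S) ?(co_qr S). Qed.

Lemma G_bounds : 0 < G /\ 2 * G <= r%:Z.
Proof.
have [[[E1 E2] E3] E4] := (rhoE S, lt_pr S, p_gt1 S, sig_lt S).
have [E5 E6] := (rho_gt0 S, le_rs S).
by case: (e1P S) => E; split; nia.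
Qed.

Lemma B_bounds : 0 < B /\ 2 * B <= q%:Z.
Proof.
have [[[E1 E2] E3] E4] := (sigE S, lt_pq S, p_gt1 S, sig_lt S).
have [E5 E6] := (rho_gt0 S, le_rs S).
by case: (e2P S) => E; split; nia.
Qed.

Definition lift := coord_lift p_gt0 q_gt0 r_gt0 (co_pq S) (co_pr S) (co_qr S).

(** The case [K = 0], where the reduced coordinates vanish; it splits a relation between differences
    of coordinates into three divisibilities and a balance of periods. *)
Lemma lift0 x y z t :
    x * (q%:Z * r%:Z) + y * (p%:Z * r%:Z) + z * (p%:Z * q%:Z) =
      t * (p%:Z * q%:Z * r%:Z) ->
  exists i j k, [/\ x = i * p%:Z, y = j * q%:Z, z = k * r%:Z & t = i + j + k].
Proof.
have z0 m n : residue m n 0 = 0 by rewrite /residue mul0r mod0z.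
have /= := @lift 0 x y z t; rewrite add0r => H /H[i [j [k]]].
rewrite /overflow /coord_a /coord_b /coord_c !z0 !mul0r !add0r ?subr0 ?oppr0 ?div0z ?add0r => ?.
by exists i, j, k.
Qed.

Lemma step_q K : let K' := K + e1 * q%:Z in
  [/\ a K' = a K + rho - (p%:Z <= a K + rho)%R%:Z * p%:Z, b K' = b K,
      c K' = c K - G + (c K < G)%R%:Z * r%:Z
    & f K' = f K - (p%:Z <= a K + rho)%R%:Z + (c K < G)%R%:Z].
Proof.
move=> K'; have [G0 G2] := G_bounds.
have [[rho0 rs] sp] := (rho_gt0 S, le_rs S, sig_lt S).
have /lift[i [j [k [Ei Ej Ek Ef]]]] : (a K + rho) * (q%:Z * r%:Z) + b K * (p%:Z * r%:Z) +
    (c K - G) * (p%:Z * q%:Z) = K' + f K * (p%:Z * q%:Z * r%:Z).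
  have := coordsE K; rewrite /K' => E.
  have E2 : rho * r%:Z * q%:Z = (G * p%:Z + e1) * q%:Z by rewrite (rhoE S).
  lia.
have Hi := carryD (t := rho) (a_bounds K) (a_bounds K') ltac:(lia) Ei.
have Hk := carryB (t := G) (c_bounds K) (c_bounds K') ltac:(lia) Ek.
have Hj := carry0 (b_bounds K) (b_bounds K') Ej.
split; [lia | lia | lia |].
rewrite Ef -Hi; lia.
Qed.

Lemma step_r K : let K' := K + e2 * r%:Z in
  [/\ a K' = a K + sig - (p%:Z <= a K + sig)%R%:Z * p%:Z,
      b K' = b K - B + (b K < B)%R%:Z * q%:Z, c K' = c K
    & f K' = f K - (p%:Z <= a K + sig)%R%:Z + (b K < B)%R%:Z].
Proof.
move=> K'; have [B0 B2] := B_bounds.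
have [[rho0 rs] sp] := (rho_gt0 S, le_rs S, sig_lt S).
have /lift[i [j [k [Ei Ej Ek Ef]]]] : (a K + sig) * (q%:Z * r%:Z) + (b K - B) * (p%:Z * r%:Z) +
    c K * (p%:Z * q%:Z) = K' + f K * (p%:Z * q%:Z * r%:Z).
  have := coordsE K; rewrite /K' => E.
  have E2 : sig * q%:Z * r%:Z = (B * p%:Z + e2) * r%:Z by rewrite (sigE S).
  lia.
have Hi := carryD (t := sig) (a_bounds K) (a_bounds K') ltac:(lia) Ei.
have Hk := carryB (t := B) (b_bounds K) (b_bounds K') ltac:(lia) Ej.
have Hj := carry0 (c_bounds K) (c_bounds K') Ek.
split; [lia | lia | lia |].
rewrite Ef -Hi; lia.
Qed.

Definition is_rep K : int := (f K == 0)%R%:Z.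
Definition square K := is_rep K - is_rep (K + e1 * q%:Z) - is_rep (K + e2 * r%:Z)
  + is_rep (K + e1 * q%:Z + e2 * r%:Z).

(** Satisfied when the four corners lie below [p q r]; it leaves few possible overflows in each
    zone. *)
Definition square_nonneg K := [/\ 0 <= f K, 0 <= f (K + e1 * q%:Z),
  0 <= f (K + e2 * r%:Z) & 0 <= f (K + e1 * q%:Z + e2 * r%:Z)].

(** As [rho + sig < p], shifting [a] by [rho] and then by [sig] carries at most once in total,
    exactly when [p <= a + rho + sig]. *)
Lemma square_overflows K : [/\ f (K + e1 * q%:Z) = f K - (p%:Z <= a K + rho)%R%:Z + (c K < G)%R%:Z,
   f (K + e2 * r%:Z) = f K - (p%:Z <= a K + sig)%R%:Z + (b K < B)%R%:Z
 & f (K + e1 * q%:Z + e2 * r%:Z) =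
   f K - (p%:Z <= a K + rho + sig)%R%:Z + (b K < B)%R%:Z + (c K < G)%R%:Z].
Proof.
have [a1 b1 _ f1] := step_q K; have [_ _ _ f2] := step_r K.
have [_ _ _ f3] := step_r (K + e1 * q%:Z).
have [[rho0 rs] sp] := (rho_gt0 S, le_rs S, sig_lt S).
split=> //; rewrite f3 f1 a1 b1; have aK := a_bounds K.
by case: (leP p%:Z (a K + rho)) => h1 /=; case: leP => h2 /=; case: leP => h3 /=; lia.
Qed.

(** The four zones are cut out by which of the shifts of [a] by [rho], [sig] and [rho + sig] pass
    [p]. Within a zone the overflows depend only on [f K] and the tests [b < B], [c < G]. *)
Lemma square_zone1 K : square_nonneg K -> a K < p%:Z - rho - sig ->
  square K = [&& f K == 0, b K < B & c K < G]%R%:Z.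
Proof.
have [[rho0 rs] sp] := (rho_gt0 S, le_rs S, sig_lt S).
case=> f0 + + + Ha; have aK := a_bounds K; rewrite /square /is_rep.
have [-> -> ->] := square_overflows K.
have -> : (p%:Z <= a K + rho) = false by lia.
have -> : (p%:Z <= a K + sig) = false by lia.
have -> : (p%:Z <= a K + rho + sig) = false by lia.
by case: (b K < B); case: (c K < G) => /=; lia.
Qed.

Lemma square_zone2 K : square_nonneg K -> p%:Z - rho - sig <= a K < p%:Z - sig ->
  square K = ((f K == 0) || [&& f K == 1, B <= b K & G <= c K])%R%:Z
  /\ (f K = 0 -> (b K < B) || (c K < G)).
Proof.
have [[rho0 rs] sp] := (rho_gt0 S, le_rs S, sig_lt S).
case=> f0 + + + Ha; have aK := a_bounds K; rewrite /square /is_rep.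
have [-> -> ->] := square_overflows K.
have -> : (p%:Z <= a K + rho) = false by lia.
have -> : (p%:Z <= a K + sig) = false by lia.
have -> : (p%:Z <= a K + rho + sig) = true by lia.
rewrite (leNgt B) (leNgt G).
by case: (b K < B); case: (c K < G) => /=; lia.
Qed.

Lemma square_zone3 K : square_nonneg K -> p%:Z - sig <= a K < p%:Z - rho -> -1 <= square K <= 0.
Proof.
have [[rho0 rs] sp] := (rho_gt0 S, le_rs S, sig_lt S).
case=> f0 + + + Ha; have aK := a_bounds K; rewrite /square /is_rep.
have [-> -> ->] := square_overflows K.
have -> : (p%:Z <= a K + rho) = false by lia.
have -> : (p%:Z <= a K + sig) = true by lia.
have -> : (p%:Z <= a K + rho + sig) = true by lia.
by case: (b K < B); case: (c K < G) => /=; lia.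
Qed.

Lemma square_zone4 K : square_nonneg K -> p%:Z - rho <= a K ->
  -1 <= square K <= 0 /\ (square K = 0 -> 2 <= f K \/ (f K = 1 /\ b K < B /\ c K < G)).
Proof.
have [[rho0 rs] sp] := (rho_gt0 S, le_rs S, sig_lt S).
case=> f0 + + + Ha; have aK := a_bounds K; rewrite /square /is_rep.
have [-> -> ->] := square_overflows K.
have -> : (p%:Z <= a K + rho) = true by lia.
have -> : (p%:Z <= a K + sig) = true by lia.
have -> : (p%:Z <= a K + rho + sig) = true by lia.
by case: (b K < B); case: (c K < G) => /=; lia.
Qed.

End Steps.

(** * Large sums over a window *)

Section Window.
Variables (p q r : nat) (rho sig G B e1 e2 K0 : int).
Hypothesis S : steps p q r rho sig G B e1 e2.

Local Notation a := (coord_a p q r).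
Local Notation b := (coord_b p q r).
Local Notation c := (coord_c p q r).
Local Notation f := (overflow p q r).
Local Notation T := (square p q r e1 e2).
Local Notation W K := (K0 <= K < K0 + p%:Z).
Local Notation count := (count_from p K0).

Let bnds := (rho_gt0 S, le_rs S, sig_lt S, (lt_pq S, lt_pr S, p_gt1 S)).

Definition window_sum : int := \sum_(i < p) T (K0 + i%:Z).

(** Modulo [p] one has [K = a q r], so equal values of [a] give integers congruent modulo [p], in a
    window of length [p]. *)
Lemma a_inj K K' : W K -> W K' -> a K = a K' -> K = K'.
Proof.
move=> WK WK' E; have := coordsE S K; have := coordsE S K'; rewrite E => E1 E2.
have [m Em] : exists m : int, K - K' = p%:Z * m.
  exists ((b K - b K') * r%:Z + (c K - c K') * q%:Z
          - (f K - f K') * (q%:Z * r%:Z)); lia.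
have [m1 m2] : -1 < m /\ m < 1 by split; nia.
have m0 : m = 0 by lia.
by rewrite m0 in Em; lia.
Qed.

Lemma count_a (g : nat -> bool) :
  count (fun K => g `|a K|%N) = (\sum_(j < p) g j)%N.
Proof.
have p0 : (0 < p)%N by have := p_gt1 S; lia.
have aP i : (`|a (K0 + i)|%N < p)%N by have := a_bounds S (K0 + i); lia.
pose h (i : 'I_p) : 'I_p := Ordinal (aP i%:Z).
have h_inj : injective h.
  move=> i i' /(congr1 (@nat_of_ord _)) /= E.
  have /a_inj : a (K0 + i%:Z) = a (K0 + i'%:Z).
    by have := a_bounds S (K0 + i%:Z); have := a_bounds S (K0 + i'%:Z); lia.
  move=> /(_ (in_window K0 i) (in_window K0 i')) E'; apply: val_inj => /=; lia.
by rewrite [RHS](reindex_inj h_inj).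
Qed.

Definition a_in (x y K : int) := x <= a K < y.

Lemma count_a_in (x y : int) : 0 <= x -> x <= y -> y <= p%:Z ->
  (count (a_in x y))%:Z = y - x.
Proof.
move=> x0 xy yp.
have -> : count (a_in x y) =
    count (fun K => (`|x| <= `|a K| < `|y|)%N).
  apply: eq_bigr => i _; rewrite /a_in; have := a_bounds S (K0 + i%:Z) => aP.
  by congr (nat_of_bool _); lia.
by rewrite (count_a (fun j => `|x| <= j < `|y|)%N) sum_ord_interval; lia.
Qed.

Definition in_box (K : int) := (b K < B) && (c K < G).

(* With [K = a q r + b p r + c p q - f p q r], the number [a - p f] is the
   coefficient of [q r] once [f] has been absorbed. *)
Lemma in_box_upper K : in_box K ->
  K <= (a K - f K * p%:Z + rho + sig) * (q%:Z * r%:Z) - e1 * q%:Z - e2 * r%:Z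
    - p%:Z * r%:Z - p%:Z * q%:Z.
Proof.
move=> /andP[bB cG]; have h := coordsE S K.
have hb : b K * (p%:Z * r%:Z) <= (B - 1) * (p%:Z * r%:Z).
  by rewrite ler_wpM2r; lia.
have hc : c K * (p%:Z * q%:Z) <= (G - 1) * (p%:Z * q%:Z).
  by rewrite ler_wpM2r; lia.
have E1 : rho * r%:Z * q%:Z = (G * p%:Z + e1) * q%:Z by rewrite (rhoE S).
have E2 : sig * q%:Z * r%:Z = (B * p%:Z + e2) * r%:Z by rewrite (sigE S).
lia.
Qed.

(** On the window [a - p f] is injective. Its values at box points span less than [rho + sig],
    because [K] is always at least [(a - p f) q r] and, in the box, exceeds it by at most
    [(rho + sig) q r - p]. *)
Lemma count_box : (count in_box)%:Z <= rho + sig.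
Proof.
have [[[[[rho0 rs] sp] lpq] lpr] p1] :=
  (rho_gt0 S, le_rs S, sig_lt S, lt_pq S, lt_pr S, p_gt1 S).
suff : (count in_box <= `|(rho + sig)%R|)%N by lia.
apply: (@count_from_range _ _ _ (fun K => a K - f K * p%:Z)).
  move=> K K' WK WK' _ _ E; apply: a_inj => //.
  have := @carry0 _ _ _ (f K - f K') (a_bounds S K) (a_bounds S K') ltac:(lia).
  by move=> e; rewrite (_ : f K = f K') in E; lia.
move=> K K' WK WK' /in_box_upper Ey _.
have h := coordsE S K'; have [b0 c0] := (b_bounds S K', c_bounds S K').
set x := a K' - _; set y := a K - _ in Ey *.
have Ex : x * (q%:Z * r%:Z) <= K'.
  suff : 0 <= b K' * (p%:Z * r%:Z) /\ 0 <= c K' * (p%:Z * q%:Z) by rewrite /x; lia.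
  by split; rewrite !mulr_ge0; lia.
have small : - e1 * q%:Z - e2 * r%:Z - p%:Z * r%:Z - p%:Z * q%:Z + p%:Z <= 0.
  by have [-> | ->] := e1P S; have [-> | ->] := e2P S; nia.
suff : x * (q%:Z * r%:Z) < (y + rho + sig) * (q%:Z * r%:Z).
  by rewrite ltr_pM2r ?mulr_gt0; lia.
lia.
Qed.

Definition core (K : int) := [&& a K < p%:Z - rho - sig, in_box K & f K == 0].

(* Outside the core one expects [a] to be large and [b < B] to be equivalent to
   [c < G]; the exceptional points are the others. *)
Definition exceptional (K : int) :=
  ~~ core K && ((a K < p%:Z - rho - sig) || ((b K < B) (+) (c K < G))).

Lemma coreP (K : int) : core K ->
  [/\ 0 <= a K < p%:Z - rho - sig, 0 <= b K < B, 0 <= c K < G & f K = 0].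
Proof.
case/and3P=> aK /andP[bK cK] /eqP ->.
have [[a0 b0] c0] := (a_bounds S K, b_bounds S K, c_bounds S K).
by split=> //; lia.
Qed.

(** The two increments of [b] differ by a multiple of [q] of absolute value below [2 B <= q], hence
    agree; likewise those of [c]. The balance of periods then settles [a]. *)
Lemma core_diff (K L d : int) : core K -> core (K + d) -> core L -> core (L + d) ->
  [/\ a (K + d) - a K = a (L + d) - a L, b (K + d) - b K = b (L + d) - b L
    & c (K + d) - c K = c (L + d) - c L].
Proof.
move=> /coreP[_ b1 c1 f1] /coreP[_ b2 c2 f2] /coreP[_ b3 c3 f3] /coreP[_ b4 c4 f4].
have [[B0 B2] [G0 G2]] := (B_bounds S, G_bounds S).
have [[h1 h2] [h3 h4]] :=
  (coordsE S K, coordsE S (K + d), (coordsE S L, coordsE S (L + d))).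
rewrite f1 in h1; rewrite f2 in h2; rewrite f3 in h3; rewrite f4 in h4.
have [i [j [k [Ei Ej Ek E]]]] := @lift0 _ _ _ _ _ _ _ _ _ S
  (a (K + d) - a K - (a (L + d) - a L)) (b (K + d) - b K - (b (L + d) - b L))
  (c (K + d) - c K - (c (L + d) - c L)) 0 ltac:(lia).
have j0 : j = 0.
  have [j1 j2] : -1 < j /\ j < 1 by clear -Ej b1 b2 b3 b4 B2; split; nia.
  by clear -j1 j2; lia.
have k0 : k = 0.
  have [k1 k2] : -1 < k /\ k < 1 by clear -Ek c1 c2 c3 c4 G2; split; nia.
  by clear -k1 k2; lia.
have i0 : i = 0 by clear -E j0 k0; lia.
by rewrite i0 mul0r in Ei; rewrite j0 mul0r in Ej; rewrite k0 mul0r in Ek; split; lia.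
Qed.

(* The coordinates of [K + 1] are the midpoints of those of [K] and [K + 2] up to
   half-periods; an even number of half-periods occurs in total. *)
Lemma midpoint_exceptional (K : int) :
  core K -> core (K + 2) -> ~~ core (K + 1) -> exceptional (K + 1).
Proof.
move=> /coreP[a1 b1 c1 f1] /coreP[a2 b2 c2 f2] nC; rewrite /exceptional nC /=.
have [[B0 B2] [G0 G2]] := (B_bounds S, G_bounds S).
have [[a3 b3] c3] := (a_bounds S (K + 1), b_bounds S (K + 1), c_bounds S (K + 1)).
have [[h1 h2] h3] := (coordsE S K, coordsE S (K + 2), coordsE S (K + 1)).
rewrite f1 in h1; rewrite f2 in h2.
have [i [j [k [Ei Ej Ek E]]]] := @lift0 _ _ _ _ _ _ _ _ _ S
  (2 * a (K + 1) - a K - a (K + 2)) (2 * b (K + 1) - b K - b (K + 2))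
  (2 * c (K + 1) - c K - c (K + 2)) (2 * f (K + 1)) ltac:(lia).
have [[[rho0 rs] sp] [[lpq lpr] p1]] := bnds.
have i1 : -1 <= i <= 1 by clear -Ei a1 a2 a3 rho0 rs p1; nia.
have j1 : -1 <= j <= 1 by clear -Ej b1 b2 b3 B2; nia.
have k1 : -1 <= k <= 1 by clear -Ek c1 c2 c3 G2; nia.
have nC' : ~ [/\ a (K + 1) < p%:Z - rho - sig, b (K + 1) < B, c (K + 1) < G &
    f (K + 1) = 0].
  by move=> [h4 h5 h6 h7]; move: nC; rewrite /core /in_box h4 h5 h6 h7.
clear h1 h2 h3 f1 f2 nC.
(* If [i = 0], then [a (K + 1)] is the midpoint of two values below [p - rho - sig]. Otherwise [i]
   is odd while [i + j + k = 2 f] is even, so exactly one of [j] and [k] vanishes and the two tests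
   disagree. *)
have [i0|i0] := eqVneq i 0; first by rewrite i0 in Ei; apply/orP; left; lia.
apply/orP; right.
have [j0|j0] := eqVneq j 0.
  have bB : b (K + 1) < B by rewrite j0 in Ej; lia.
  have k2 : k = 1 \/ k = -1 by lia.
  by have -> : c (K + 1) < G = false; [case: k2 => k2; rewrite k2 in Ek; lia | rewrite bB].
have k0 : k = 0 by lia.
have cG : c (K + 1) < G by rewrite k0 in Ek; lia.
have j2 : j = 1 \/ j = -1 by lia.
by have -> : b (K + 1) < B = false; [case: j2 => j2; rewrite j2 in Ej; lia | rewrite cG].
Qed.

Let P (i : nat) := core (K0 + i%:Z).
Let X (i : nat) := exceptional (K0 + i%:Z).

(** * Lines through the core *)

Section Line.
Variables u v w : int.
Hypothesis uvw : u * (q%:Z * r%:Z) + v * (p%:Z * r%:Z) + w * (p%:Z * q%:Z) = 1.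
Hypothesis core_succ : forall K : int, core K -> core (K + 1) ->
  [/\ a (K + 1) = a K + u, b (K + 1) = b K + v & c (K + 1) = c K + w].

(** By [uvw] the displacement [(u, v, w)] raises [K] by 1; [i], [j], [k] are winding numbers, and
    they compensate the overflow acquired. *)
Lemma line (K n : int) : f K = 0 -> exists i j k,
  [/\ a K + n * u = a (K + n) + i * p%:Z, b K + n * v = b (K + n) + j * q%:Z,
    c K + n * w = c (K + n) + k * r%:Z & f (K + n) + i + j + k = 0].
Proof.
move=> f0; have h := coordsE S K; rewrite f0 in h.
have E : (a K + n * u) * (q%:Z * r%:Z) + (b K + n * v) * (p%:Z * r%:Z) +
    (c K + n * w) * (p%:Z * q%:Z) = (K + n) + 0 * (p%:Z * q%:Z * r%:Z).
  have : n * (u * (q%:Z * r%:Z) + v * (p%:Z * r%:Z) + w * (p%:Z * q%:Z)) = n.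
    by rewrite uvw mulr1.
  lia.
by have [i [j [k [? ? ? ?]]]] := lift S E; exists i, j, k.
Qed.

Lemma run_coords (K : int) (m : nat) : (forall j, (j <= m)%N -> core (K + j%:Z)) ->
  [/\ a (K + m%:Z) = a K + m%:Z * u, b (K + m%:Z) = b K + m%:Z * v
    & c (K + m%:Z) = c K + m%:Z * w].
Proof.
elim: m => [|m IHm] H; first by rewrite !mul0r !addr0.
have [E1 E2 E3] := IHm (fun j h => H j (leqW h)).
have ES : K + m.+1%:Z = K + m%:Z + 1 by lia.
have := core_succ (H m (leqnSn m)); rewrite -ES => /(_ (H _ (leqnn _))).
by rewrite E1 E2 E3 => -[-> -> ->]; split; lia.
Qed.

(** Both ends of the run lie in [[0, p - rho - sig) x [0, B) x [0, G)], which limits the total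
    displacement. *)
Lemma run_small (K : int) (m : nat) : (forall j, (j <= m)%N -> core (K + j%:Z)) ->
  [/\ m%:Z * `|u| < p%:Z - rho - sig, m%:Z * `|v| < B & m%:Z * `|w| < G].
Proof.
move=> H; have [E1 E2 E3] := run_coords H.
have [[a1 b1 c1 _] [a2 b2 c2 _]] := (coreP (H m (leqnn m)), coreP (H 0%N isT)).
rewrite addr0 in a2 b2 c2; rewrite E1 in a1; rewrite E2 in b1; rewrite E3 in c1.
have n0 x : m%:Z * `|x| = `|m%:Z * x| by rewrite normrM.
by rewrite !n0; split; lia.
Qed.

(* If fewer than [l] exceptional points lie between [e] and [s], the line from
   [K0 + e] to [K0 + s] does not wind around in any coordinate, so [K0 + e + 1]
   is in the core by convexity. *)
Lemma gap_exceptional (l e s : nat) :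
    l%:Z * `|u| < p%:Z - rho - sig -> l%:Z * `|v| < B -> l%:Z * `|w| < G ->
    (e.+1 < s)%N -> P e -> P s -> (forall j, (e < j < s)%N -> ~~ P j) ->
  (\sum_(i < e.+1) X i + l <= \sum_(i < s) X i)%N.
Proof.
move=> lu lv lw es Pe Ps none; rewrite leqNgt; apply/negP => few.
have [[[rho0 rs] sp] [[lpq lpr] p1]] := bnds.
have [[B0 B2] [G0 G2]] := (B_bounds S, G_bounds S).
have [[a1 b1 c1 f1] [a2 b2 c2 f2]] := (coreP Pe, coreP Ps).
pose K := K0 + e%:Z; pose n := (s - e)%N.
have Kn : K0 + s%:Z = K + n%:Z by rewrite /K /n; lia.
rewrite Kn in a2 b2 c2 f2; rewrite -/K in a1 b1 c1 f1.
have [Nx [Ny [Nz [Ex Ey Ez N0]]]] := line n%:Z f1.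
rewrite f2 add0r in N0.
(* None of these points is in the core, so [l] consecutive indices without a good one would be [l]
   exceptional points, against [few]. *)
have dense j : (l < j <= n)%N -> exists2 j' : nat, (j - l <= j' < j)%N &
    (p%:Z - rho - sig <= ((a K + j'%:Z * u) %% p%:Z)%Z) &&
    ((((b K + j'%:Z * v) %% q%:Z)%Z < B) == (((c K + j'%:Z * w) %% r%:Z)%Z < G)).
  move=> jn.
  have [/existsP[i /andP[ij nXi]]|allX] :=
      boolP [exists i : 'I_j, (j - l <= i)%N && ~~ X (e + i)%N]; last first.
    exfalso; have H1 : (\sum_(i < e.+1) X i <= \sum_(i < (e + (j - l))%N) X i)%N.
      by apply: cnt_mono; lia.
    have H2 : (\sum_(i < (e + j)%N) X i <= \sum_(i < s) X i)%N.
      by apply: cnt_mono; rewrite /n in jn; lia.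
    have : (\sum_(i < (e + j)%N) X i =
        \sum_(i < (e + (j - l))%N) X i + (e + j - (e + (j - l))))%N.
      apply: cnt_all; first lia.
      move=> i ij; move/existsPn: allX.
      have ij' : (i - e < j)%N by lia.
      move=> /(_ (Ordinal ij')) /=; rewrite subnKC; last by lia.
      by rewrite negb_and negbK => /orP[|//]; lia.
    lia.
  have ilt := ltn_ord i; exists i; first by rewrite ij ilt.
  have nPi : ~~ P (e + i)%N by apply: none; rewrite /n in jn; lia.
  have Ki : K0 + (e + i)%N%:Z = K + i%:Z by rewrite /K; lia.
  move: nXi; rewrite /X /exceptional; move: nPi; rewrite /P Ki => -> /=.
  have [ix [iy [iz [-> -> -> _]]]] := line i%:Z f1.
  rewrite (addrC (a _)) (addrC (b _)) (addrC (c _)) !modzMDl.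
  rewrite !modz_small ?(a_bounds S) ?(b_bounds S) ?(c_bounds S) //.
  by rewrite negb_or -leNgt; case: (_ < B); case: (_ < G).
have n0 : (0 < n)%N by rewrite /n; lia.
have [x0 y0 z0] := no_winding (p := p%:Z) (q := q%:Z) (r := r%:Z)
  (l := p%:Z - rho - sig)
  ltac:(lia) ltac:(lia) B0 B2 G0 G2 a1 b1 c1 a2 b2 c2 Ex Ey Ez N0 lu lv lw dense n0.
move: Ex Ey Ez; rewrite x0 y0 z0 !mul0r !addr0 => Ex Ey Ez.
have n2 : (1 < n)%N by rewrite /n; lia.
have conv M x t y : 0 <= x < M -> 0 <= y < M -> x + n%:Z * t = y -> 0 <= x + t < M.
  by clear -n2; move=> xM yM E; nia.
have [xa [yb zc]] : 0 <= a K + u < p%:Z - rho - sig /\ 0 <= b K + v < B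
    /\ 0 <= c K + w < G.
  by split; [|split]; [apply: conv a1 a2 Ex | apply: conv b1 b2 Ey |
    apply: conv c1 c2 Ez].
have [ix [iy [iz []]]] := line 1 f1; rewrite !mul1r => Fx Fy Fz F0.
have ix0 := carry0 (m := p%:Z) (x := a K + u) ltac:(lia) (a_bounds S _) Fx.
have iy0 := carry0 (m := q%:Z) (x := b K + v) ltac:(lia) (b_bounds S _) Fy.
have iz0 := carry0 (m := r%:Z) (x := c K + w) ltac:(lia) (c_bounds S _) Fz.
have := none e.+1 ltac:(lia).
rewrite /P (_ : K0 + e.+1%:Z = K + 1) ?/core ?/in_box; last by rewrite /K; lia.
rewrite ix0 mul0r addr0 in Fx; rewrite iy0 mul0r addr0 in Fy.
rewrite iz0 mul0r addr0 in Fz.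
by rewrite -Fx -Fy -Fz; lia.
Qed.
End Line.

(** * Bounds on the window sum and on the number of exceptional points *)

Hypothesis nonneg : forall K : int, W K -> square_nonneg p q r e1 e2 K.

Definition bad (K : int) := T K < (a K < p%:Z - sig)%R%:Z.

Lemma square_le_ideal (K : int) : W K -> T K <= (a K < p%:Z - sig)%R%:Z.
Proof.
move=> /nonneg sq; have [[[rho0 rs] sp] [[lpq lpr] p1]] := bnds.
have aP := a_bounds S K.
have [lt|ge] := ltP (a K) (p%:Z - rho - sig).
  by rewrite (square_zone1 S sq lt) (_ : a K < p%:Z - sig); [case: [&& _, _ & _] | lia].
have [lt|ge2] := ltP (a K) (p%:Z - sig).
  by rewrite (square_zone2 S sq _).1 ?ge //; case: (_ || _).
have [lt|ge3] := ltP (a K) (p%:Z - rho).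
  by have := square_zone3 S sq; rewrite ge2 lt => /(_ isT)/andP[].
by have [/andP[]] := square_zone4 S sq ge3.
Qed.

(** Only the [sig] residues [a >= p - sig] can give -1. As [sig < p / 2], this settles the negative
    side of the final absolute value. *)
Lemma window_sum_lower : - sig <= window_sum.
Proof.
have [[[rho0 rs] sp] [[lpq lpr] p1]] := bnds.
have E := @count_a_in (p%:Z - sig) p%:Z
  ltac:(lia) ltac:(lia) ltac:(lia).
suff : - (count (a_in (p%:Z - sig) p%:Z))%:Z <= window_sum by lia.
rewrite count_fromZ -sumrN ler_sum // => i _.
have sq := nonneg (in_window K0 i); rewrite /a_in.
move: (K0 + _) sq => K sq; have aP := a_bounds S K.
have [lt|ge] := ltP (a K) (p%:Z - rho - sig).
  by rewrite (square_zone1 S sq lt); case: [&& _, _ & _]; lia.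
have [lt|ge2] := ltP (a K) (p%:Z - sig).
  by rewrite (square_zone2 S sq _).1 ?ge //; case: (_ || _).
have [lt|ge3] := ltP (a K) (p%:Z - rho).
  by have := square_zone3 S sq; rewrite ge2 lt => /(_ isT); lia.
by have [] := square_zone4 S sq ge3; lia.
Qed.

Lemma window_sum_bad : window_sum <= p%:Z - sig - (count bad)%:Z.
Proof.
have [[[rho0 rs] sp] [[lpq lpr] p1]] := bnds.
have E := @count_a_in 0 (p%:Z - sig)
  ltac:(lia) ltac:(lia) ltac:(lia).
rewrite -[p%:Z - sig]subr0 -E !count_fromZ -sumrB ler_sum // => i _.
have WK := in_window K0 i; move: (K0 + _) WK => K WK.
have := square_le_ideal WK; have aP := a_bounds S K.
by rewrite /bad /a_in; lia.
Qed.

(** Positive terms come only from the [rho] residues of the second zone and from box points, at most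
    [rho + sig] by [count_box]. *)
Lemma window_sum_box : window_sum <= 2 * rho + sig.
Proof.
have [[[rho0 rs] sp] [[lpq lpr] p1]] := bnds.
have E := @count_a_in (p%:Z - rho - sig) (p%:Z - sig)
  ltac:(lia) ltac:(lia) ltac:(lia).
have E' := count_box.
suff : window_sum <=
    (count (a_in (p%:Z - rho - sig) (p%:Z - sig)))%:Z + (count in_box)%:Z by lia.
rewrite !count_fromZ -big_split ler_sum // => i _.
have WK := in_window K0 i; move: (K0 + _) WK => K WK /=.
have := square_le_ideal WK; have := square_zone1 S (nonneg WK).
rewrite /a_in /in_box.
have [lt /(_ isT) -> _|ge _] := ltP (a K) (p%:Z - rho - sig); last by lia.
by case: (b K < B); case: (c K < G); lia.
Qed.

Lemma good_core (K : int) : W K -> ~~ bad K -> a K < p%:Z - rho - sig -> core K.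
Proof.
move=> /nonneg sq; have [[[rho0 rs] sp] [[lpq lpr] p1]] := bnds.
rewrite /bad => gd lt; move: gd; rewrite (square_zone1 S sq lt) /core lt /in_box.
have -> : (a K < p%:Z - sig) by lia.
by case: (f K == 0); case: (b K < B); case: (c K < G).
Qed.

Hypothesis large : 2 * p%:Z < 3 * window_sum.

(** So [sig] and the number of bad points add up to less than [p / 3]; with [rho_bound] this also
    gives [rho > p / 6]. *)
Lemma bad_bound : 3 * (count bad)%:Z + 3 * sig + 1 <= p%:Z.
Proof. by have := window_sum_bad; move: large; lia. Qed.

Lemma rho_bound : 2 * p%:Z + 1 <= 6 * rho + 3 * sig.
Proof. by have := window_sum_box; move: large; lia. Qed.

Lemma count_core_ge : p%:Z - rho - sig - (count bad)%:Z <= (count core)%:Z.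
Proof.
have [[[rho0 rs] sp] [[lpq lpr] p1]] := bnds.
have E := @count_a_in 0 (p%:Z - rho - sig)
  ltac:(lia) ltac:(lia) ltac:(lia).
have : (count (a_in 0%R (p%:Z - rho - sig)%R) <= count core + count bad)%N.
  apply: leq_count_fromD => K WK /andP[_ lt].
  by have [//|gd] := boolP (bad K); rewrite ?orbT // good_core.
lia.
Qed.

(** The core has more than [sig] points, with distinct [a], so some [a] is small and, in
    [core_right], some [a] is large. The first point bounds the window from above, the second from
    below. *)
Lemma core_left : exists K : int, [/\ W K, core K & a K <= p%:Z - 2 * sig - rho].
Proof.
have [[[rho0 rs] sp] [[lpq lpr] p1]] := bnds.
have [h1 h2] := (count_core_ge, bad_bound).
have E := @count_a_in (p%:Z - 2 * sig - rho + 1)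
  (p%:Z - rho - sig) ltac:(lia) ltac:(lia) ltac:(lia).
have /count_from_gt[K [WK CK aK]] : (count (a_in (p%:Z - 2 * sig - rho + 1)%R
  (p%:Z - rho - sig)%R) < count core)%N by lia.
exists K; split=> //; move: aK CK; rewrite /a_in /core; lia.
Qed.

Lemma core_right : exists K : int, [/\ W K, core K & sig - 1 <= a K].
Proof.
have [[[rho0 rs] sp] [[lpq lpr] p1]] := bnds.
have [h1 h2] := (count_core_ge, bad_bound).
have E := @count_a_in 0 (sig - 1)
  ltac:(lia) ltac:(lia) ltac:(lia).
have /count_from_gt[K [WK CK aK]] :
  (count (a_in 0%R (sig - 1)%R) < count core)%N by lia.
exists K; split=> //; have := a_bounds S K; move: aK; rewrite /a_in; lia.
Qed.

Let rho_qr : rho * r%:Z * q%:Z = (G * p%:Z + e1) * q%:Z.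
Proof. by rewrite (rhoE S). Qed.
Let sig_qr : sig * q%:Z * r%:Z = (B * p%:Z + e2) * r%:Z.
Proof. by rewrite (sigE S). Qed.

(** Since [B p r = sig q r - e2 r] and [G p q = rho q r - e1 q], a point outside the box would be at
    least about [(p - sig) q r]; the core point of [core_left] keeps the window below that. *)
Lemma overflow0_in_box (K : int) : W K -> f K = 0 -> p%:Z - rho - sig <= a K ->
  (b K < B) || (c K < G) -> in_box K.
Proof.
move=> WK f0 aK bc; have [[[rho0 rs] sp] [[lpq lpr] p1]] := bnds.
have [L [WL /and3P[_ /(in_box_upper) upL /eqP fL] aL]] := core_left.
have h := coordsE S K; rewrite f0 in h.
have [[b0 c0] aP] := (b_bounds S K, c_bounds S K, a_bounds S K).
have ha : (p%:Z - rho - sig) * (q%:Z * r%:Z) <= a K * (q%:Z * r%:Z).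
  by rewrite ler_wpM2r // mulr_ge0.
have hL : (a L - f L * p%:Z + rho + sig) * (q%:Z * r%:Z)
    <= (p%:Z - sig) * (q%:Z * r%:Z).
  by rewrite ler_wpM2r ?mulr_ge0 // fL; lia.
have rsq : rho * (q%:Z * r%:Z) <= sig * (q%:Z * r%:Z).
  by rewrite ler_wpM2r ?mulr_ge0.
have b0' : 0 <= b K * (p%:Z * r%:Z) by rewrite !mulr_ge0; lia.
have c0' : 0 <= c K * (p%:Z * q%:Z) by rewrite !mulr_ge0; lia.
have sm1 : p%:Z + q%:Z < p%:Z * q%:Z + p%:Z * r%:Z by nia.
have sm2 : p%:Z + r%:Z < p%:Z * q%:Z + p%:Z * r%:Z by nia.
have [e1q e2r] : - q%:Z <= e1 * q%:Z /\ - r%:Z <= e2 * r%:Z.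
  by split; [have [->|->] := e1P S | have [->|->] := e2P S]; lia.
rewrite /in_box; have [bB|bB] := ltP (b K) B; last first.
  have hb : B * (p%:Z * r%:Z) <= b K * (p%:Z * r%:Z) by rewrite ler_wpM2r ?mulr_ge0.
  lia.
have [//|cG] := ltP (c K) G.
have hc : G * (p%:Z * q%:Z) <= c K * (p%:Z * q%:Z) by rewrite ler_wpM2r ?mulr_ge0.
lia.
Qed.

(** The mirror image: with [b < B] or [c < G], such a [K] would lie more than [p] below
    [(sig - 1) q r], hence too far below the core point of [core_right]. *)
Lemma overflow2_outside (K : int) : W K -> 2 <= f K -> B <= b K /\ G <= c K.
Proof.
move=> WK f2; have [[[rho0 rs] sp] [[lpq lpr] p1]] := bnds.
have [L [WL /and3P[_ _ /eqP fL] aL]] := core_right.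
have h := coordsE S K; have hL := coordsE S L; rewrite fL in hL.
have [[b0 c0] aP] := (b_bounds S K, c_bounds S K, a_bounds S K).
have [bL0 cL0] := (b_bounds S L, c_bounds S L).
have ha : a K * (q%:Z * r%:Z) <= (p%:Z - 1) * (q%:Z * r%:Z).
  by rewrite ler_wpM2r ?mulr_ge0 //; lia.
have haL : (sig - 1) * (q%:Z * r%:Z) <= a L * (q%:Z * r%:Z).
  by rewrite ler_wpM2r ?mulr_ge0.
have rsq : rho * (q%:Z * r%:Z) <= sig * (q%:Z * r%:Z).
  by rewrite ler_wpM2r ?mulr_ge0.
have bL' : 0 <= b L * (p%:Z * r%:Z) by rewrite !mulr_ge0; lia.
have cL' : 0 <= c L * (p%:Z * q%:Z) by rewrite !mulr_ge0; lia.
have hf : 2 * (p%:Z * q%:Z * r%:Z) <= f K * (p%:Z * q%:Z * r%:Z).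
  by rewrite ler_wpM2r ?mulr_ge0.
have sm1 : p%:Z + q%:Z < p%:Z * q%:Z + p%:Z * r%:Z by nia.
have sm2 : p%:Z + r%:Z < p%:Z * q%:Z + p%:Z * r%:Z by nia.
have [e1q e2r] : - q%:Z <= e1 * q%:Z /\ - r%:Z <= e2 * r%:Z.
  by split; [have [->|->] := e1P S | have [->|->] := e2P S]; lia.
have hb x : b K <= x -> b K * (p%:Z * r%:Z) <= x * (p%:Z * r%:Z).
  by move=> bx; rewrite ler_wpM2r ?mulr_ge0.
have hc x : c K <= x -> c K * (p%:Z * q%:Z) <= x * (p%:Z * q%:Z).
  by move=> cx; rewrite ler_wpM2r ?mulr_ge0.
split; rewrite leNgt; apply/negP => lt.
  have := hb (B - 1) ltac:(lia); have := hc (r%:Z - 1) ltac:(lia); lia.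
have := hb (q%:Z - 1) ltac:(lia); have := hc (G - 1) ltac:(lia); lia.
Qed.

(** Outside the third zone, a point attaining the ideal value passes both tests [b < B] and [c < G]
    or neither. The third zone has only [sig - rho] residues. *)
Lemma exceptional_bad (K : int) : W K -> exceptional K ->
  bad K || a_in (p%:Z - sig) (p%:Z - rho) K.
Proof.
move=> WK /andP[nC] /orP[lt|xbc].
  by apply/orP; left; apply: contraR nC => gd; exact: good_core.
have sq := nonneg WK; have [[[rho0 rs] sp] [[lpq lpr] p1]] := bnds.
have [bd //=|gd] := boolP (bad K); rewrite /a_in /=.
have [lt|ge] := ltP (a K) (p%:Z - rho - sig).
  by have := good_core WK gd lt; rewrite (negPf nC).
move: gd; rewrite /bad.
have [lt|ge2] := ltP (a K) (p%:Z - sig).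
  have [-> _] := square_zone2 S sq ltac:(by rewrite ge lt).
  have [/eqP f0 _|_ /=] := boolP (f K == 0).
    have := overflow0_in_box WK f0 ge.
    by move: xbc; rewrite /in_box; case: (b K < B); case: (c K < G) => //= _ /(_ isT).
  rewrite (leNgt B) (leNgt G).
  by move: xbc; case: (b K < B); case: (c K < G); rewrite ?andbF.
have [//|ge3] := ltP (a K) (p%:Z - rho).
have [T0 T0f] := square_zone4 S sq ge3 => gd.
have /T0f[/(overflow2_outside WK)|[_ [bB cG]]] : T K = 0 by lia.
  by rewrite !leNgt; move: xbc; case: (b K < B); case: (c K < G) => //= _ [].
by move: xbc; rewrite bB cG.
Qed.

Lemma count_exceptional :
  (count exceptional)%:Z <= (count bad)%:Z + sig - rho.
Proof.
have [[[rho0 rs] sp] [[lpq lpr] p1]] := bnds.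
have E := @count_a_in (p%:Z - sig) (p%:Z - rho)
  ltac:(lia) ltac:(lia) ltac:(lia).
have := leq_count_fromD exceptional_bad; lia.
Qed.

(** The input of [single_run]: the two counts combine with [5 / 3] of [bad_bound] and [1 / 3] of
    [rho_bound]. *)
Lemma count_core : 3 * (count exceptional)%:Z + 2 <= (count core)%:Z.
Proof.
have [[[rho0 rs] sp] _] := bnds.
have [[h1 h2] [h3 h4]] := (count_core_ge, count_exceptional, (bad_bound, rho_bound)).
lia.
Qed.

(* Otherwise [sum_sparse] leaves only the case where the core is the arithmetic
   progression [K0, K0 + 3, ...], with [p = 3 sig + 1] and [rho = sig]. *)
Lemma core_consecutive : exists K : int, [/\ W K, W (K + 1), core K & core (K + 1)].
Proof.
have [[[rho0 rs] sp] [[lpq lpr] p1]] := bnds.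
have [ex|nex] := boolP [exists i : 'I_p, (i.+1 < p)%N && (P i && P i.+1)].
  case/existsP: ex => i /and3P[ip Pi Pi1]; exists (K0 + i%:Z).
  by rewrite (_ : K0 + i%:Z + 1 = K0 + i.+1%:Z); [split=> //; lia | lia].
exfalso.
have Padj i : (i.+1 < p)%N -> P i -> ~~ P i.+1.
  move=> ip Pi; move/existsPn: nex => /(_ (Ordinal (ltnW ip))) /=.
  by rewrite ip Pi.
have PX i : (i.+2 < p)%N -> P i -> P i.+2 -> X i.+1.
  move=> ip Pi Pi2; have := Padj i (ltnW ip) Pi.
  rewrite /P /X (_ : K0 + i.+1%:Z = K0 + i%:Z + 1); last by lia.
  apply: midpoint_exceptional => //.
  by rewrite (_ : K0 + i%:Z + 2 = K0 + i.+2%:Z); last by lia.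
have [n pn] : exists n : nat, p = n.+2 by exists p.-2; lia.
have [[[h1 h2] h3] h4] := (count_core_ge, bad_bound,
  count_exceptional, rho_bound).
have hs : (3 * count core <= p + count exceptional + 2)%N.
  have H1 i : (i < n.+1)%N -> P i -> ~~ P i.+1 by move=> ip; apply: Padj; lia.
  have H2 i : (i < n)%N -> P i -> P i.+2 -> X i.+1 by move=> ip; apply: PX; lia.
  have := sum_sparse H1 H2; rewrite -pn.
  have SS (Q : nat -> bool) : (\sum_(i < p) Q i = \sum_(i < n.+1) Q i + Q n.+1)%N.
    by rewrite pn big_ord_recr.
  rewrite [count exceptional](SS X).
  have -> : (\sum_(i < p) P i = count core)%N by [].
  by have := Padj n ltac:(lia); case: (P n); case: (P n.+1) => /=; lia.
(* Writing [bad] for the number of bad points, [hs] and the counts give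
   [p <= rho + 2 sig + 2 bad + 1], against [p >= 3 sig + 3 bad + 1]: equality holds throughout and
   [bad = 0]. *)
have [ers ep] : rho = sig /\ p%:Z = 3 * sig + 1 by lia.
have [m em] : exists m : nat, sig = m%:Z by exists `|sig|%N; lia.
have pm : p = (3 * m).+1 by lia.
have X0 i : (i < p)%N -> ~~ X i.
  have : count exceptional = 0%N by lia.
  move=> /eqP; rewrite sum_nat_eq0 => /forallP H ip.
  by have := H (Ordinal ip); rewrite /= eqb0.
have P3 : forall j, (j <= m)%N -> P (3 * j)%N.
  apply: sum_gap3.
  - by move=> i ip; apply: Padj; lia.
  - move=> i ip Pi; apply: contra (X0 i.+1 ltac:(lia)) => Pi2.
    by apply: PX Pi Pi2; lia.
  by rewrite -pm; change (m < count core)%N; lia.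
pose u := a (K0 + 3) - a K0.
have m0 : (0 < m)%N by lia.
have [C0 C3] : core K0 /\ core (K0 + 3).
  by have := P3 0%N isT; have := P3 1%N m0; rewrite /P muln0 muln1 addr0.
have aj j : (j <= m)%N -> a (K0 + (3 * j)%N%:Z) = a K0 + j%:Z * u.
  elim: j => [|j IHj] jm; first by rewrite muln0 mul0r !addr0.
  have Ej : K0 + (3 * j.+1)%N%:Z = K0 + (3 * j)%N%:Z + 3 by lia.
  have := core_diff C0 C3 (P3 j (ltnW jm)); rewrite -Ej => /(_ (P3 _ jm))[E _ _].
  by have := IHj (ltnW jm); rewrite Ej in E *; rewrite /u; lia.
have [[[am _ _ _] [a0 _ _ f0]] [_ _ _ f3]] := (coreP (P3 m (leqnn m)), coreP C0, coreP C3).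
(* The [m = sig] steps of size [u] stay inside [[0, p - 2 sig) = [0, sig + 1)]. *)
have u1 : -1 <= u <= 1.
  by move: am; rewrite aj // => am; clear -am a0 ep ers em m0; nia.
have V := coordsE S K0; have V3 := coordsE S (K0 + 3); rewrite f0 in V; rewrite f3 in V3.
set v := b (K0 + 3) - b K0; set w := c (K0 + 3) - c K0.
have E3 : u * (q%:Z * r%:Z) + v * (p%:Z * r%:Z) + w * (p%:Z * q%:Z) = 3.
  by rewrite /u /v /w; lia.
have Erq : sig * q%:Z * (rho * r%:Z) = (B * p%:Z + e2) * (G * p%:Z + e1).
  by rewrite (rhoE S) (sigE S).
(* Multiplying [3 = u q r] by [3 rho sig = sig (p - 1)] modulo [p]. *)
have [t Et] : exists t : int, 3 * u * (e1 * e2) - 1 = p%:Z * t.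
  exists (p%:Z - 2 - 3 * u * (B * G * p%:Z + B * e1 + G * e2)
          - 3 * (sig * sig) * (v * r%:Z + w * q%:Z)).
  have E9 : 9 * (sig * sig) = (p%:Z - 1) * (p%:Z - 1) by rewrite ep; ring.
  have Eu : 3 * (sig * sig) * (u * (q%:Z * r%:Z)) =
      3 * (sig * sig) * (3 - v * (p%:Z * r%:Z) - w * (p%:Z * q%:Z)).
    by congr (_ * _); lia.
  rewrite ers in Erq.
  have Ee : 3 * u * (e1 * e2) = 3 * u * (sig * q%:Z * (sig * r%:Z)
      - (B * p%:Z * (G * p%:Z) + B * p%:Z * e1 + e2 * (G * p%:Z))).
    by rewrite Erq; ring.
  by rewrite Ee; clear -E9 Eu; lia.
have s1 : 3 * u * (e1 * e2) - 1 = 2 \/ 3 * u * (e1 * e2) - 1 = - 4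
    \/ 3 * u * (e1 * e2) - 1 = - 1.
  have [u0|[u0|u0]] : u = 0 \/ u = 1 \/ u = -1 by clear -u1; lia.
  - by rewrite u0 mulr0 mul0r; lia.
  - by rewrite u0; have [->|->] := e1P S; have [->|->] := e2P S; lia.
  - by rewrite u0; have [->|->] := e1P S; have [->|->] := e2P S; lia.
(* Being odd and greater than 1, [p] divides none of 2, 4 and 1. *)
have p2 : p%:Z = 2 * p./2%:Z + 1 by have := odd_double_half p; rewrite (p_odd S); lia.
have t1 : -4 <= t <= 2 by clear -s1 Et p1; nia.
have [e|[e|[e|[e|[e|[e|e]]]]]] : t = -4 \/ t = -3 \/ t = -2 \/ t = -1 \/ t = 0 \/
  t = 1 \/ t = 2 by clear -t1; lia.
all: rewrite e in Et; clear -s1 Et p2 p1; lia.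
Qed.

(** The increments over one consecutive pair in the core serve for all such pairs by [core_diff].
    Taking for [l] the greatest run length, [gap_exceptional] and [count_core] let [single_run]
    conclude. *)
Lemma core_run : exists (u v w : int) (K : int) (m : nat),
  [/\ u * (q%:Z * r%:Z) + v * (p%:Z * r%:Z) + w * (p%:Z * q%:Z) = 1,
     W K /\ core K, (count core <= m.+1)%N &
     [/\ m%:Z * `|u| < p%:Z - rho - sig, m%:Z * `|v| < B & m%:Z * `|w| < G]].
Proof.
have [K1 [W1 W1' C1 C1']] := core_consecutive.
pose u := a (K1 + 1) - a K1; pose v := b (K1 + 1) - b K1.
pose w := c (K1 + 1) - c K1.
have [[_ _ _ f1] [_ _ _ f1']] := (coreP C1, coreP C1').
have [h h'] := (coordsE S K1, coordsE S (K1 + 1)).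
rewrite f1 in h; rewrite f1' in h'.
have uvw : u * (q%:Z * r%:Z) + v * (p%:Z * r%:Z) + w * (p%:Z * q%:Z) = 1.
  by rewrite /u /v /w; lia.
have succ (K : int) : core K -> core (K + 1) ->
    [/\ a (K + 1) = a K + u, b (K + 1) = b K + v & c (K + 1) = c K + w].
  move=> CK CK'; have [Eu Ev Ew] := core_diff C1 C1' CK CK'.
  by rewrite /u /v /w; split; lia.
pose Q (m : nat) := [exists i : 'I_p, (i + m < p)%N && [forall j : 'I_m.+1, P (i + j)%N]].
have QP m : reflect (exists i, (i + m < p)%N /\ forall j, (j <= m)%N -> P (i + j)%N) (Q m).
  apply: (iffP existsP) => [[i /andP[ip /forallP H]]|[i [ip H]]].
    by exists i; split=> // j jm; exact: (H (Ordinal (jm : (j < m.+1)%N))).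
  have ip' : (i < p)%N by lia.
  exists (Ordinal ip'); rewrite ip; apply/forallP => j; exact: H (ltn_ord j).
have Q1 : Q 1%N.
  apply/QP; exists `|K1 - K0|%N; split; first lia.
  move=> j j1; have [->|->] : j = 0%N \/ j = 1%N by lia.
    by rewrite /P (_ : K0 + _ = K1) //; lia.
  by rewrite /P (_ : K0 + _ = K1 + 1) //; lia.
have Qle m : Q m -> (m <= p)%N by move=> /QP[i [ip _]]; lia.
have [l /QP[i0 [ip0 H0]] lmax] := ex_maxnP (ex_intro _ 1%N Q1) Qle.
have small i m : (i + m < p)%N -> (forall j, (j <= m)%N -> P (i + j)%N) ->
    [/\ m%:Z * `|u| < p%:Z - rho - sig, m%:Z * `|v| < B & m%:Z * `|w| < G].
  move=> im H; apply: (run_small uvw succ (K := K0 + i%:Z)) => j jm.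
  by have := H j jm; rewrite /P (_ : K0 + (i + j)%N%:Z = K0 + i%:Z + j%:Z) //; lia.
have [lu lv lw] := small _ _ ip0 H0.
have run_le i m : (i + m < p)%N -> (forall j, (j <= m)%N -> P (i + j)%N) -> (m <= l)%N.
  by move=> im H; apply: lmax; apply/QP; exists i.
have gap_ge e s : (e.+1 < s < p)%N -> P e -> P s ->
    (forall j, (e < j < s)%N -> ~~ P j) ->
    (\sum_(i < e.+1) X i + l <= \sum_(i < s) X i)%N.
  by move=> /andP[es _] Pe Ps none; exact (gap_exceptional uvw lu lv lw es Pe Ps none).
have l0 : (0 < l)%N by exact: lmax.
have := count_core => hc.
have many : (3 * (\sum_(i < p) X i) + 2 <= \sum_(i < p) P i)%N.
  by change (3 * count exceptional + 2 <= count core)%N; lia.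
have [s [m [sm Em H]]] := single_run l0 run_le gap_ge many.
exists u, v, w, (K0 + s%:Z), m; split=> //; last exact: small sm H.
- by split; [lia | have := H 0%N isT; rewrite addn0].
- by rewrite -Em.
Qed.

(** Bad points, box points and the [sig] residues in [[x, y)] number at most [bad + rho + 2 sig],
    which is below [p] by [bad_bound]. *)
Lemma exists_point (x y : int) (Q' : int -> bool) :
    0 <= x -> x <= y -> y <= p%:Z -> y - x = sig ->
    (forall K, W K -> ~~ bad K -> ~~ in_box K -> ~~ a_in x y K -> Q' K) ->
  exists2 K : int, W K & Q' K.
Proof.
move=> x0 xy yp xys H; have [[[rho0 rs] sp] [[lpq lpr] p1]] := bnds.
have [h1 h2] := (bad_bound, count_box).
have E1 := count_a_in x0 xy yp.
have E2 := @count_a_in 0 p%:Z ltac:(lia) ltac:(lia) ltac:(lia).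
pose Q K := [|| bad K, in_box K | a_in x y K].
have Q1 : (count Q <= count bad + count (fun K => in_box K || a_in x y K)%R)%N.
  exact: leq_count_fromD.
have Q2 : (count (fun K => in_box K || a_in x y K)%R <= count in_box + count (a_in x y))%N.
  exact: leq_count_fromD.
have /count_from_gt[K [WK _ nQ]] : (count Q < count (a_in 0%R p%:Z))%N by lia.
by exists K => //; move: nQ; rewrite /Q !negb_or => /and3P[]; exact: H.
Qed.

(** Excluding [a >= p - sig] leaves the first two zones, and in the first a point that is not bad
    lies in the core, hence in the box. *)
Lemma exists_zone2_outside : exists2 K : int, W K &
  [&& p%:Z - rho - sig <= a K < p%:Z - sig, f K == 1, B <= b K & G <= c K].
Proof.
have [[[rho0 rs] sp] [[lpq lpr] p1]] := bnds.
apply: (exists_point (x := p%:Z - sig) (y := p%:Z)); try lia.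
move=> K WK gd nbox; rewrite /a_in => aK; have sq := nonneg WK.
have aP := a_bounds S K; have lt : a K < p%:Z - sig by lia.
have [lt1|ge] := ltP (a K) (p%:Z - rho - sig).
  by have /and3P[_ bx _] := good_core WK gd lt1; rewrite bx in nbox.
have [sqE sqf] := square_zone2 S sq ltac:(rewrite ge; exact: lt).
rewrite lt /=; move: gd; rewrite /bad lt sqE.
have [/eqP f0 _|_ /=] := boolP (f K == 0); last by case: (f K == 1) => //; lia.
by have := overflow0_in_box WK f0 ge (sqf f0); rewrite (negPf nbox).
Qed.

(** The excluded zones two and three together have exactly [sig] residues. *)
Lemma exists_zone4_outside : exists2 K : int, W K & (p%:Z - rho <= a K) && (2 <= f K).
Proof.
have [[[rho0 rs] sp] [[lpq lpr] p1]] := bnds.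
apply: (exists_point (x := p%:Z - rho - sig) (y := p%:Z - rho)); try lia.
move=> K WK gd nbox; rewrite /a_in => aK; have sq := nonneg WK.
have aP := a_bounds S K.
have [lt1|ge] := ltP (a K) (p%:Z - rho - sig).
  by have /and3P[_ bx _] := good_core WK gd lt1; rewrite bx in nbox.
have ge2 : p%:Z - rho <= a K by lia.
rewrite ge2 /=; have [T0 T0f] := square_zone4 S sq ge2; move: gd; rewrite /bad.
have -> : (a K < p%:Z - sig) = false by lia.
rewrite -leNgt /= => T_ge0; have /T0f[//|[_ [bB cG]]] : T K = 0 by lia.
by rewrite /in_box bB cG in nbox.
Qed.

Lemma window_sum_contradiction : False.
Proof.
have [[[rho0 rs] sp] [[lpq lpr] p1]] := bnds.
have [u [v [w [K [m [uvw [WK CK] cm [mu mv mw]]]]]]] := core_run.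
have [h1 h2] := (bad_bound, count_core_ge).
have [[B0 B2] [G0 G2]] := (B_bounds S, G_bounds S).
have [aK bK cK fK] := coreP CK.
have m_sig : sig <= m%:Z by lia.
have u_small : `|u| <= 1 by clear -mu cm h1 h2 rho0 rs; nia.
(* As [B / sig] is close to [q / p] and [G / rho] to [r / p], the second and third coordinates move
   by less than one period over the window. *)
have pv : p%:Z * `|v| < q%:Z.
  have : sig * `|v| < B by apply: le_lt_trans mv; rewrite ler_wpM2r.
  by have := sigE S; have := e2P S; clear -rho0 rs p1; nia.
have pw : p%:Z * `|w| < r%:Z.
  have : rho * `|w| < G by apply: le_lt_trans mw; rewrite ler_wpM2r //; lia.
  by have := rhoE S; have := e1P S; clear -rho0 rs p1; nia.
have [q0 r0] : 0 < q%:Z /\ 0 < r%:Z by lia.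
have u1 : u = 1 \/ u = -1.
  suff : u != 0 by lia.
  apply/eqP => u0; have : p%:Z * (v * r%:Z + w * q%:Z) = 1.
    by rewrite -uvw u0; ring.
  move: (_ + _) => t; clear -p1; (have [?|?] : t <= 0 \/ 1 <= t by lia); nia.
(* Since [p |w| < r], a [v] not opposite in sign to [u] would give the sum in [uvw] absolute value
   at least [q]. *)
have uv : u * v < 0.
  rewrite ltNge; apply/negP => vge.
  have := uvw; case: u1 vge => ->; rewrite ?mul1r ?mulN1r => vge E;
    clear -E vge pw q0 r0 lpq p1; nia.
have uw : u * w < 0.
  rewrite ltNge; apply/negP => wge.
  have := uvw; case: u1 wge => ->; rewrite ?mul1r ?mulN1r => wge E;
    clear -E wge pv q0 r0 lpr p1; nia.
have drift n : `|n| < p%:Z -> [/\ `|n * u| < p%:Z, `|n * v| < q%:Z, `|n * w| < r%:Z,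
    0 <= n * u -> n * v <= 0 /\ n * w <= 0 & n * u <= 0 -> 0 <= n * v /\ 0 <= n * w].
  move=> np; rewrite !normrM; split.
  - by case: u1 => ->; lia.
  - apply: le_lt_trans pv; rewrite ler_wpM2r //; lia.
  - apply: le_lt_trans pw; rewrite ler_wpM2r //; lia.
  - by case: u1 uv uw => ->; clear; rewrite ?mulr1 ?mul1r ?mulrN1 ?mulN1r => *; split; nia.
  - by case: u1 uv uw => ->; clear; rewrite ?mulr1 ?mul1r ?mulrN1 ?mulN1r => *; split; nia.
have [H WH /and4P[aH /eqP fH bH cH]] := exists_zone2_outside.
have [H' WH' /andP[aH' fH']] := exists_zone4_outside.
have [U1 V1 W1 P1 _] := drift (H - K) ltac:(lia).
have [U2 V2 W2 _ N2] := drift (H' - K) ltac:(lia).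
have [i [j [k [Ei Ej Ek Ef]]]] := line uvw (H - K) fK.
have [i' [j' [k' [Ei' Ej' Ek' Ef']]]] := line uvw (H' - K) fK.
have [KH KH'] : K + (H - K) = H /\ K + (H' - K) = H' by split; lia.
rewrite KH in Ei Ej Ek Ef; rewrite KH' in Ei' Ej' Ek' Ef'.
have [[bHq cHr] [bH'q cH'r]] := (b_bounds S H, c_bounds S H, (b_bounds S H', c_bounds S H')).
have [aHp aHp'] := (a_bounds S H, a_bounds S H').
(* Otherwise [b] and [c] do not increase along the line, so to leave the box at [H] each wraps once;
   as [f H = 1], this forces [i = 1], and [a] would travel more than [p]. *)
have neg : (H - K) * u < 0.
  rewrite ltNge; apply/negP => pos; have [v0 w0] := P1 pos.
  have j1 : j = -1 by clear -Ej v0 V1 bK bH bHq; nia.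
  have k1 : k = -1 by clear -Ek w0 W1 cK cH cHr; nia.
  have i1 : i = 1 by lia.
  by rewrite i1 in Ei; lia.
(* Otherwise [b] and [c] do not decrease, so only [a] can wrap below 0, and at most once; the
   overflow at [H'] would be at most 1. *)
have pos : 0 < (H' - K) * u.
  rewrite ltNge; apply/negP => le0; have [v0 w0] := N2 le0.
  have j1 : 0 <= j' by clear -Ej' v0 bK bH'q; nia.
  have k1 : 0 <= k' by clear -Ek' w0 cK cH'r; nia.
  have i1 : -1 <= i' by clear -Ei' U2 aK aHp'; nia.
  by lia.
have i1 : i = -1.
  by clear -Ei U1 neg aK aH rs rho0; nia.
have i1' : i' = 0.
  by clear -Ei' U2 pos aK aH' aHp' rs rho0; nia.
rewrite i1 in Ei; rewrite i1' in Ei'.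
(* This difference equals [a H' - a H + p > p], whereas [H] and [H'] lie in a window of length
   [p]. *)
have : (H' - K) * u - (H - K) * u = (H' - H) * u by ring.
by case: u1 => u1; rewrite u1 in Ei Ei' *; lia.
Qed.

End Window.

(** * Coefficients of [Phi_(pqr)] *)

Section Coefficients.
Variables p q r : nat.
Hypotheses (p_pr : prime p) (q_pr : prime q) (r_pr : prime r).
Hypotheses (neq_pq : p != q) (neq_pr : p != r) (neq_qr : q != r).

Local Notation f := (overflow p q r).
Local Notation D := (is_rep p q r).

Let p_gt0 : (0 < p)%N := prime_gt0 p_pr.
Let q_gt0 : (0 < q)%N := prime_gt0 q_pr.
Let r_gt0 : (0 < r)%N := prime_gt0 r_pr.

Let co_prime x y : prime x -> prime y -> x != y -> coprime x y.
Proof. by move=> x_pr y_pr; rewrite prime_coprime // dvdn_prime2. Qed.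

Let co_pq := co_prime p_pr q_pr neq_pq.
Let co_pr := co_prime p_pr r_pr neq_pr.
Let co_qr := co_prime q_pr r_pr neq_qr.
Let coordsE := coordE p_gt0 q_gt0 r_gt0 co_pq co_pr co_qr.

Lemma is_rep_neg (K : int) : K < 0 -> D K = 0.
Proof.
move=> K0; rewrite /is_rep; case: eqP => // f0; have := coordsE K.
rewrite f0 mul0r addr0 => E.
have [[[a0 _] [b0 _]] [c0 _]] :=
  (andP (coord_a_bounds q r p_gt0 K), andP (coord_b_bounds p r q_gt0 K), andP (coord_c_bounds p q r_gt0 K)).
by move: K0; rewrite -E ltNge !addr_ge0 ?mulr_ge0.
Qed.

Lemma overflow_ge0 (K : int) : K < (p * q * r)%N%:Z -> 0 <= f K.
Proof.
move=> KN; have := coordsE K.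
have [[[a0 _] [b0 _]] [c0 _]] :=
  (andP (coord_a_bounds q r p_gt0 K), andP (coord_b_bounds p r q_gt0 K), andP (coord_c_bounds p q r_gt0 K)).
have : 0 <= coord_a p q r K * (q%:Z * r%:Z) + coord_b p q r K * (p%:Z * r%:Z)
    + coord_c p q r K * (p%:Z * q%:Z) by rewrite !addr_ge0 ?mulr_ge0.
move=> + E; rewrite E; rewrite !PoszM in KN; move: (p%:Z * _ * _) KN => N KN h.
by rewrite leNgt; apply/negP => f0; nia.
Qed.

Definition box_poly : {poly int} :=
  \sum_(i < p) \sum_(j < q) \sum_(k < r) 'X^(q * r * i + p * r * j + p * q * k).

Lemma box_poly_prod : box_poly = (\sum_(i < p) 'X^(q * r) ^+ i) *
  (\sum_(j < q) 'X^(p * r) ^+ j) * (\sum_(k < r) 'X^(p * q) ^+ k).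
Proof.
rewrite big_distrlr big_distrl; apply: eq_bigr => i _ /=.
rewrite big_distrl; apply: eq_bigr => j _ /=.
by rewrite big_distrr; apply: eq_bigr => k _ /=; rewrite -!exprM -!exprD.
Qed.

(** By uniqueness of coordinates, at most one triple of exponents produces [n], and one does exactly
    when the overflow is 0. *)
Lemma coef_box_poly (n : nat) : box_poly`_n = D n%:Z.
Proof.
have [a1 b1] := (coord_a_bounds q r p_gt0 n%:Z, coord_b_bounds p r q_gt0 n%:Z).
have c1 := coord_c_bounds p q r_gt0 n%:Z; have E0 := coordsE n%:Z.
have ia : (`|coord_a p q r n%:Z| < p)%N by lia.
have ib : (`|coord_b p q r n%:Z| < q)%N by lia.
have ic : (`|coord_c p q r n%:Z| < r)%N by lia.
have E i j k : (i < p)%N -> (j < q)%N -> (k < r)%N ->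
    (n == q * r * i + p * r * j + p * q * k)%N =
    [&& i == `|coord_a p q r n%:Z|, j == `|coord_b p q r n%:Z|,
        k == `|coord_c p q r n%:Z| & f n%:Z == 0]%N.
  move=> ip jq kr; apply/eqP/and4P => [e|[/eqP-> /eqP-> /eqP-> /eqP f0]].
    have /(coord_lift p_gt0 q_gt0 r_gt0 co_pq co_pr co_qr)[x [y [z [Ex Ey Ez Ef]]]] :
        i%:Z * (q%:Z * r%:Z) + j%:Z * (p%:Z * r%:Z) + k%:Z * (p%:Z * q%:Z) =
        n%:Z + 0 * (p%:Z * q%:Z * r%:Z) by rewrite e; lia.
    have x0 := carry0 (m := p%:Z) (x := i%:Z) ltac:(lia) a1 Ex.
    have y0 := carry0 (m := q%:Z) (x := j%:Z) ltac:(lia) b1 Ey.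
    have z0 := carry0 (m := r%:Z) (x := k%:Z) ltac:(lia) c1 Ez.
    rewrite x0 mul0r addr0 in Ex; rewrite y0 mul0r addr0 in Ey.
    rewrite z0 mul0r addr0 in Ez; rewrite -Ex -Ey -Ez.
    by split=> //; lia.
  rewrite f0 mul0r addr0 in E0; apply/eqP; rewrite -eqz_nat -{1}E0.
  by apply/eqP; rewrite !PoszD !PoszM !gez0_abs; [ring | lia..].
rewrite /box_poly coef_sum (bigD1 (Ordinal ia)) //= coef_sum (bigD1 (Ordinal ib)) //=.
rewrite coef_sum (bigD1 (Ordinal ic)) //= coefXn E // !eqxx /=.
rewrite !big1 ?addr0 //.
- exact: natz.
- by move=> i ni; rewrite coef_sum big1 // => j _; rewrite coef_sum big1 // => k _;
  rewrite coefXn E //; move: ni; rewrite -val_eqE /= => /negPf->.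
- by move=> j nj; rewrite coef_sum big1 // => k _;
  rewrite coefXn E //; move: nj; rewrite -val_eqE /= => /negPf->; rewrite andbF.
- by move=> k nk; rewrite coefXn E //; move: nk; rewrite -val_eqE /= => /negPf->; rewrite !andbF.
Qed.

Lemma coef_XnM_box_poly (e n : nat) : ('X^e * box_poly)`_n = D (n%:Z - e%:Z).
Proof.
rewrite coefXnM coef_box_poly; case: ltnP => en; first by rewrite is_rep_neg //; lia.
by congr D; lia.
Qed.

(** The three factors of [box_poly] turn [X^(q r) - 1], [X^(p r) - 1] and [X^(p q) - 1] into
    [X^(p q r) - 1]; one such factor and [X - 1] then cancel. *)
Lemma Cyclotomic_box :
  'Phi_(p * q * r) * ('X^(p * q * r) - 1) ^+ 2 =
  (\sum_(i < p) 'X^i) * ('X^q - 1) * ('X^r - 1) * box_poly.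
Proof.
have nz m : (0 < m)%N -> 'X^m - 1 != 0 :> {poly int}.
  by move=> m0; rewrite -size_poly_eq0 size_XnsubC.
have N0 : (0 < p * q * r)%N by rewrite !muln_gt0 p_gt0 q_gt0.
have := Cyclotomic_three_primes p_pr q_pr r_pr neq_pq neq_pr neq_qr.
move=> /(congr1 ( *%R^~ box_poly)) /=; rewrite {1}box_poly_prod.
have E x y m : (x * y = m)%N ->
    ('X^x - 1) * (\sum_(i < y) 'X^x ^+ i) = 'X^m - 1 :> {poly int}.
  by move=> <-; rewrite -subrX1 -exprM.
have [E1 E2] := (@E (q * r)%N p (p * q * r)%N ltac:(lia), @E (p * r)%N q (p * q * r)%N ltac:(lia)).
have E3 := @E (p * q)%N r (p * q * r)%N ltac:(lia).
have E4 := subrX1 ('X : {poly int}) p; rewrite E4.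
move: E1 E2 E3 {E4}; move: (\sum_(i < p) _ ^+ i) (\sum_(j < q) _) (\sum_(k < r) _) => s1 s2 s3.
move: (\sum_(i < p) 'X^i) => M E1 E2 E3 H.
apply: (mulIf (nz _ N0)); apply: (mulIf (nz 1%N isT)); rewrite expr1.
transitivity ('Phi_(p * q * r) * ('X^(p * q) - 1) * ('X^(p * r) - 1) * ('X^(q * r) - 1) *
     ('X - 1) * (s1 * s2 * s3)).
  have EE : ('X^(p * q * r) - 1) ^+ 2 * ('X^(p * q * r) - 1) =
      ('X^(q * r) - 1) * s1 * (('X^(p * r) - 1) * s2) * (('X^(p * q) - 1) * s3).
    by rewrite E1 E2 E3; ring.
  by rewrite -[_ * _ * ('X^(p * q * r) - 1)]mulrA EE; ring.
by rewrite H; ring.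
Qed.

Lemma coef_Cyclotomic (n : nat) : (n < p * q * r)%N ->
  ('Phi_(p * q * r))`_n = \sum_(i < p) (D (n%:Z - i%:Z) - D (n%:Z - i%:Z - q%:Z)
    - D (n%:Z - i%:Z - r%:Z) + D (n%:Z - i%:Z - q%:Z - r%:Z)).
Proof.
move=> nN; have := congr1 (fun P : {poly int} => P`_n) Cyclotomic_box.
(* The square is 1 plus a multiple of [X^(p q r)], so it does not affect coefficients below
   [p q r]. *)
have -> : 'Phi_(p * q * r) * ('X^(p * q * r) - 1) ^+ 2 = 'Phi_(p * q * r) +
    'X^(p * q * r) * ('Phi_(p * q * r) * ('X^(p * q * r) - 2%:R)) :> {poly int} by ring.
rewrite coefD coefXnM nN addr0 => ->.
rewrite !mulr_suml coef_sum; apply: eq_bigr => i _.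
have -> : 'X^i * ('X^q - 1) * ('X^r - 1) * box_poly = 'X^i * box_poly - 'X^(i + q) * box_poly
    - 'X^(i + r) * box_poly + 'X^(i + q + r) * box_poly by rewrite !exprD; ring.
rewrite coefD !coefB !coef_XnM_box_poly.
by congr (D _ - D _ - D _ + D _); lia.
Qed.
End Coefficients.

(** Of the inverse of [n] modulo the odd [m] and its negative, one is below [m / 2]; [e] records
    which. *)
Lemma small_inverse (m n : nat) : (1 < m)%N -> odd m -> coprime m n ->
  exists x g e : int, [/\ x * n%:Z = g * m%:Z + e, e = 1 \/ e = -1, 0 < x & 2 * x < m%:Z].
Proof.
move=> m1 m_odd co; have m0 : (0 < m)%N by lia.
have /dvdzP[g Eg] := @dvdz_residue m n 1 ltac:(by rewrite coprime_sym).
have := residue_bounds n 1 m0; move: (residue m n 1) Eg => x Eg xm.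
have x0 : x != 0 by apply/eqP => x0; rewrite x0 mulr0 subr0 in Eg; nia.
have m2 : m%:Z = 2 * m./2%:Z + 1 by have := odd_double_half m; rewrite m_odd; lia.
have [lt|ge] := ltP (2 * x) m%:Z.
  by exists x, (- g), 1; split; [lia | left | lia | lia].
by exists (m%:Z - x), (n%:Z + g), (-1); split; [lia | right | lia | lia].
Qed.

(** * From window sums to coefficients *)

Section Bound.
Variables (p q r : nat) (rho sig G B e1 e2 : int).
Hypotheses (p_pr : prime p) (q_pr : prime q) (r_pr : prime r) (neq_qr : q != r).
Hypothesis S : steps p q r rho sig G B e1 e2.

Lemma coef_Cyclotomic_le (n : nat) : (n < p * q * r)%N ->
  3 * `|('Phi_(p * q * r))`_n| <= 2 * p%:Z.
Proof.
move=> nN; have [lpq lpr] := (lt_pq S, lt_pr S).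
have neq_pq : p != q by lia.
have neq_pr : p != r by lia.
(* The arguments [n - i] are read upwards from [n - (p - 1)]. When [e1 = 1] the corners are [K] and
   [K + q], so the window starts [q] lower, and similarly for [e2] and [r]; exchanging corners gives
   the sign [e1 e2]. *)
pose K0 := n%:Z - (p%:Z - 1) - (if e1 == 1 then q%:Z else 0) - (if e2 == 1 then r%:Z else 0).
have Ec : ('Phi_(p * q * r))`_n = e1 * e2 * window_sum p q r e1 e2 K0.
  rewrite coef_Cyclotomic // /window_sum mulr_sumr (reindex_inj rev_ord_inj) /=.
  apply: eq_bigr => i _; rewrite /square /K0; have ip := ltn_ord i.
  have Ei : n%:Z - (p - i.+1)%N%:Z = n%:Z - (p%:Z - 1) + i%:Z by lia.
  rewrite Ei; move: (n%:Z - (p%:Z - 1)) => x.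
  have [->|->] := e1P S; have [->|->] := e2P S; rewrite /= ?eqxx.
  - have -> : x + i%:Z - q%:Z - r%:Z = x - q%:Z - r%:Z + i%:Z by ring.
    have -> : x - q%:Z - r%:Z + i%:Z + 1 * q%:Z = x + i%:Z - r%:Z by ring.
    have -> : x - q%:Z - r%:Z + i%:Z + 1 * r%:Z = x + i%:Z - q%:Z by ring.
    by rewrite (_ : x + i%:Z - r%:Z + 1 * r%:Z = x + i%:Z); ring.
  - have -> : x - q%:Z - 0 + i%:Z = x + i%:Z - q%:Z by ring.
    have -> : x + i%:Z - q%:Z + 1 * q%:Z = x + i%:Z by ring.
    by rewrite !mulN1r; ring.
  - have -> : x - 0 - r%:Z + i%:Z = x + i%:Z - r%:Z by ring.
    have -> : x + i%:Z - r%:Z + 1 * r%:Z = x + i%:Z by ring.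
    have -> : x + i%:Z - r%:Z + -1 * q%:Z + 1 * r%:Z = x + i%:Z - q%:Z by ring.
    by rewrite (_ : x + i%:Z - r%:Z + -1 * q%:Z = x + i%:Z - q%:Z - r%:Z); ring.
  - by rewrite !subr0 !mulN1r; ring.
have nonneg K : K0 <= K < K0 + p%:Z -> square_nonneg p q r e1 e2 K.
  move=> WK; have H x : x <= n%:Z -> 0 <= overflow p q r x.
    by move=> xn; apply: overflow_ge0 => //; lia.
  have [h1 h2] : K <= n%:Z - (if e1 == 1 then q%:Z else 0) - (if e2 == 1 then r%:Z else 0)
    /\ True by split=> //; rewrite /K0 in WK; lia.
  by split; apply: H; move: h1; have [->|->] := e1P S; have [->|->] := e2P S => /=; lia.
have lo := window_sum_lower S nonneg.
have hi : 3 * window_sum p q r e1 e2 K0 <= 2 * p%:Z.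
  by rewrite leNgt; apply/negP => /(window_sum_contradiction S nonneg).
have [rho0 [rs sp]] := (rho_gt0 S, (le_rs S, sig_lt S)).
have -> : `|('Phi_(p * q * r))`_n| = `|window_sum p q r e1 e2 K0|.
  by rewrite Ec !normrM; have [->|->] := e1P S; have [->|->] := e2P S; rewrite ?normrN1 ?normr1 !mul1r.
lia.
Qed.
End Bound.

(** The hypotheses are symmetric in [q] and [r]: exchanging them swaps [rho, G, e1] with
    [sig, B, e2], so [rho <= sig] may be assumed. *)
Lemma ternary_coef_le (p q r n : nat) :
    prime p -> prime q -> prime r -> odd p -> (p < q)%N -> (p < r)%N -> q != r ->
    (n < p * q * r)%N ->
  3 * `|('Phi_(p * q * r))`_n| <= 2 * p%:Z.
Proof.
move=> p_pr q_pr r_pr p_odd pq pr qr nN.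
have co x y : prime x -> prime y -> x != y -> coprime x y.
  by move=> x_pr y_pr; rewrite prime_coprime // dvdn_prime2.
have p1 := prime_gt1 p_pr.
have [co_pq co_pr] : coprime p q /\ coprime p r by split; apply: co => //; lia.
have co_qr : coprime q r by exact: co.
have [rho [G [e1 [Er e1P rho0 rho2]]]] := small_inverse p1 p_odd co_pr.
have [sig [B [e2 [Es e2P sig0 sig2]]]] := small_inverse p1 p_odd co_pq.
have [le|/ltW le] := leP rho sig.
  by apply: (@coef_Cyclotomic_le p q r rho sig G B e1 e2) => //.
rewrite mulnAC in nN *.
apply: (@coef_Cyclotomic_le p r q sig rho B G e2 e1) => //; first by rewrite eq_sym.
by constructor=> //; rewrite coprime_sym.
Qed.

Theorem theorem2p6 (p q r : nat)
    (p_prime : prime p) (q_prime : prime q) (r_prime : prime r)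
    (p_odd : odd p) (q_odd : odd q) (r_odd : odd r)
    (ltpq : (p < q)%N) (ltqr : (q < r)%N) :
  (cyclotomic_height (p * q * r))%:R <= 2 / 3 * p%:R :> rat.
Proof.
have height : (3 * cyclotomic_height (p * q * r) <= 2 * p)%N.
  suff : (cyclotomic_height (p * q * r) <= (2 * p) %/ 3)%N by lia.
  apply/bigmax_leqP => i _.
  have := @ternary_coef_le p q r i p_prime q_prime r_prime p_odd ltpq
    (ltn_trans ltpq ltqr) ltac:(lia).
  have -> : (i < p * q * r)%N.
    apply: leq_trans (ltn_ord i) _.
    have co x y : prime x -> prime y -> (x < y)%N -> coprime x y.
      by move=> x_pr y_pr xy; rewrite prime_coprime // dvdn_prime2 // ltn_eqF.
    have ltpr := ltn_trans ltpq ltqr.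
    rewrite !totient_coprime ?coprimeMl ?co // !totient_prime //.
    have [p0 q0] := (prime_gt0 p_prime, prime_gt0 q_prime).
    apply: (@leq_ltn_trans (p.-1 * (q * r))); last by rewrite -mulnA ltn_pmul2r; lia.
    by rewrite -mulnA leq_mul2l leq_mul ?leq_pred ?orbT.
  by move=> /(_ isT); lia.
rewrite mulrAC ler_pdivlMr //; move: height; rewrite -(ler_nat rat) !natrM.
by rewrite mulrC.
Qed.
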